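(* Let $\Lambda$ be an algebra of finite global dimension $d$. Then for every $\Lambda$-bimodule $X$ and every $n\geq d+1$, $\mathsf{HH}^n_\tau(\Lambda,X)=0=\mathsf{HH}_n^\tau(\Lambda,X)$. Moreover, if $d\ge 1$, then $\mathsf{HH}_d^\tau(\Lambda,\Lambda)=0$.
   Context: Let $k$ be a field. ''Algebra'' means a finite dimensional associative $k$-algebra $\Lambda$ with Jacobson radical $r$ such that $\Lambda/r$ is separable over $k$. All modules and bimodules are finite dimensional over $k$; $D=\mathrm{Hom}_k(-,k)$; $\otimes=\otimes_k$. $\Lambda$-bimodules are left $\Lambda\otimes\Lambda^{\mathrm{op}}$-modules, and $\mathrm{Hom}_{\Lambda-\Lambda}$ denotes bimodule morphisms. $\tau$-Hochschild (co)homology: $\Omega^{m}$ is the $m$-th syzygy of bimodules taken with minimal projective resolutions ($\Omega^0=\mathrm{id}$); $\mathrm{Tr}M$ is the transpose, i.e. the cokernel of $\mathrm{Hom}(P_0,\Lambda\otimes\Lambda^{\mathrm{op}})\to\mathrm{Hom}(P_1,\Lambda\otimes\Lambda^{\mathrm{op}})$ for a minimal projective presentation $P_1\to P_0\to M\to 0$; $\tau=D\,\mathrm{Tr}$ is the Auslander–Reiten translate for $\Lambda$-bimodules; $\tau_n=\tau\Omega^{n-1}$ for $n\ge1$. For a $\Lambda$-bimodule $X$ and $n\geq 1$: $\mathsf{HH}^n_\tau(\Lambda,X)=D\,\mathrm{Hom}_{\Lambda-\Lambda}(X,\tau_n\Lambda)$ and $\mathsf{HH}_n^\tau(\Lambda,X)=\mathrm{Hom}_{\Lambda-\Lambda}(DX,\tau_n\Lambda)$.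 *)

(* Defs.v *)
From HB Require Import structures.
From mathcomp Require Import all_boot all_order all_algebra all_field.
From mathcomp Require Import boolp.

Set Implicit Arguments.
Unset Strict Implicit.
Unset Printing Implicit Defensive.

Import GRing.Theory.
Local Open Scope ring_scope.

Lemma linfunE (k : fieldType) (U V : vectType k) (f : U -> V) :
  linear f -> linfun f =1 f.
Proof.
move=> lf x; pose F : {linear U -> V} :=
  HB.pack f (GRing.isLinear.Build k U V _ f lf).
exact: (lfunE F).
Qed.

Lemma linear_sumE (k : fieldType) (U V : lmodType k) (f : U -> V)
    (n : nat) (c : 'I_n -> k) (u : 'I_n -> U) :
  linear f -> f (\sum_i c i *: u i) = \sum_i c i *: f (u i).
Proof.
move=> lf; pose F : {linear U -> V} :=
  HB.pack f (GRing.isLinear.Build k U V _ f lf).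
by rewrite -[LHS]/(F _) linear_sum; apply: eq_bigr => i _; rewrite linearZ.
Qed.

Section Opposite.
Variables (k : fieldType) (A : falgType k).

HB.instance Definition _ := GRing.Lmodule.copy A^c A.
HB.instance Definition _ := Vector.copy A^c A.

Fact opp_scaleAl (c : k) (a b : A^c) : c *: (a * b : A^c) = (c *: a : A^c) * b.
Proof. exact: (@scalerAr k A c b a). Qed.
HB.instance Definition _ := GRing.Lmodule_isLalgebra.Build k A^c opp_scaleAl.
Fact opp_scaleAr (c : k) (a b : A^c) : c *: (a * b : A^c) = a * (c *: b : A^c).
Proof. exact: (@scalerAl k A c b a). Qed.
HB.instance Definition _ := GRing.Lalgebra_isAlgebra.Build k A^c opp_scaleAr.
End Opposite.

Section Tensor.
Variables (k : fieldType) (A B : falgType k).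

(* An element of A (x) B is stored by its coordinates in the basis (e_i (x) f_j),
   where (e_i) and (f_j) are the bases of A and B chosen by the library. *)
Definition tensor : Type := 'M[k]_(\dim {:A}, \dim {:B}).
HB.instance Definition _ := Vector.copy tensor 'M[k]_(\dim {:A}, \dim {:B}).

Definition tens (a : A) (b : B) : tensor :=
  \matrix_(i, j) (coord (vbasis fullv) i a * coord (vbasis fullv) j b).

(* The linear map A (x) B -> V induced by a bilinear map f. *)
Definition tlift (V : lmodType k) (f : A -> B -> V) (t : tensor) : V :=
  \sum_i \sum_j t i j *: f (vbasis {:A})`_i (vbasis {:B})`_j.

Lemma tlift_linear V f : linear (@tlift V f).
Proof.
move=> c t u; rewrite /tlift scaler_sumr -big_split; apply: eq_bigr => i _ /=.
rewrite scaler_sumr -big_split; apply: eq_bigr => j _ /=.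
by rewrite scalerA -scalerDl !mxE.
Qed.

Definition bilin (V : lmodType k) (f : A -> B -> V) :=
  (forall b, linear (f^~ b)) /\ (forall a, linear (f a)).

Lemma tliftE V f a b : bilin f -> @tlift V f (tens a b) = f a b.
Proof.
move=> [fl fr]; rewrite [a in RHS](coord_vbasis (memvf a)).
rewrite (linear_sumE _ _ (fl b)); apply: eq_bigr => i _.
rewrite [b in RHS](coord_vbasis (memvf b)).
rewrite (linear_sumE _ _ (fr _)) scaler_sumr; apply: eq_bigr => j _.
by rewrite mxE scalerA.
Qed.

Lemma tens_bilin : bilin tens.
Proof.
split=> [b c a a' | a c b b']; apply/matrixP=> i j; rewrite !mxE linearP /=.
  by rewrite mulrDl mulrA.
by rewrite mulrDr mulrCA.
Qed.

Lemma tens_basis (i : 'I_(\dim {:A})) (j : 'I_(\dim {:B})) :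
  tens (vbasis {:A})`_i (vbasis {:B})`_j = delta_mx i j.
Proof.
apply/matrixP=> i' j'; rewrite !mxE !coord_free ?(basis_free (vbasisP _)) //.
by rewrite -natrM mulnb ![_ == i']eq_sym ![_ == j']eq_sym.
Qed.

Lemma tensor_sum (t : tensor) :
  t = \sum_i \sum_j t i j *: tens (vbasis {:A})`_i (vbasis {:B})`_j.
Proof.
rewrite [LHS]matrix_sum_delta; apply: eq_bigr => i _; apply: eq_bigr => j _.
by rewrite tens_basis.
Qed.

Lemma tensor_ind (P : tensor -> Prop) :
  (forall a b, P (tens a b)) -> (forall t u, P t -> P u -> P (t + u)) ->
  forall t, P t.
Proof.
move=> Pt PD t.
have P0 : P 0.
  have := Pt 0 0; suff -> : tens 0 0 = 0 by [].
  by apply/matrixP=> i j; rewrite !mxE linear0 mul0r.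
rewrite (tensor_sum t).
elim/big_ind: _ => // i _; elim/big_ind: _ => // j _.
suff -> : t i j *: tens (vbasis {:A})`_i (vbasis {:B})`_j =
          tens (t i j *: (vbasis {:A})`_i) (vbasis {:B})`_j by [].
by apply/matrixP=> i' j'; rewrite !mxE linearZ mulrA.
Qed.

(* (a (x) b) * (c (x) d) = (a * c) (x) (b * d), see [tensM] *)
Definition tmul (t u : tensor) : tensor :=
  tlift (fun a b => tlift (fun c d => tens (a * c) (b * d)) u) t.

Lemma bilin_inner a b : bilin (fun c d => tens (a * c) (b * d)).
Proof.
split=> [d x c c' | c x d d'] /=.
  by rewrite mulrDr -scalerAr tens_bilin.1.
by rewrite mulrDr -scalerAr tens_bilin.2.
Qed.

Lemma tlift_lin_fun (V : lmodType k) (f g h : A -> B -> V) x t :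
  (forall a b, f a b = x *: g a b + h a b) ->
  tlift f t = x *: tlift g t + tlift h t.
Proof.
move=> fE; rewrite /tlift scaler_sumr -big_split; apply: eq_bigr => i _ /=.
rewrite scaler_sumr -big_split; apply: eq_bigr => j _ /=.
by rewrite fE scalerDr !scalerA mulrC.
Qed.

Lemma bilin_outer u : bilin (fun a b => tlift (fun c d => tens (a * c) (b * d)) u).
Proof.
split=> [b x a a' | a x b b'] /=; apply: tlift_lin_fun => c d.
  by rewrite mulrDl -scalerAl tens_bilin.1.
by rewrite mulrDl -scalerAl tens_bilin.2.
Qed.

Lemma tensM a b c d : tmul (tens a b) (tens c d) = tens (a * c) (b * d).
Proof.
by rewrite /tmul (tliftE _ _ (bilin_outer _)) (tliftE _ _ (bilin_inner _ _)).
Qed.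

Lemma tmul_linl u : linear (tmul^~ u).
Proof. exact: tlift_linear. Qed.
Lemma tmul_linr t : linear (tmul t).
Proof.
move=> x u u'; apply: tlift_lin_fun => a b; exact: tlift_linear.
Qed.
Lemma tmulDl : left_distributive tmul +%R.
Proof. by move=> t t' u; have := tmul_linl u 1 t t'; rewrite !scale1r. Qed.
Lemma tmulDr : right_distributive tmul +%R.
Proof. by move=> t u u'; have := tmul_linr t 1 u u'; rewrite !scale1r. Qed.

Lemma tmulA : associative tmul.
Proof.
elim/tensor_ind=> [a b|t t' IH IH' u v]; last by rewrite !tmulDl IH IH'.
elim/tensor_ind=> [c d|u u' IH IH' v]; last by rewrite !(tmulDl, tmulDr) IH IH'.
elim/tensor_ind=> [e f|v v' IH IH']; last by rewrite !tmulDr IH IH'.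
by rewrite !tensM !mulrA.
Qed.
Lemma tmul1l : left_id (tens 1 1) tmul.
Proof.
elim/tensor_ind=> [a b|t u IH IH']; last by rewrite tmulDr IH IH'.
by rewrite tensM !mul1r.
Qed.
Lemma tmul1r : right_id (tens 1 1) tmul.
Proof.
elim/tensor_ind=> [a b|t u IH IH']; last by rewrite tmulDl IH IH'.
by rewrite tensM !mulr1.
Qed.

Lemma tens_eq0 a b : tens a b = 0 -> a = 0 \/ b = 0.
Proof.
move=> /matrixP ab0; have [->|a0] := eqVneq a 0; [by left | right].
rewrite (coord_vbasis (memvf b)) big1 // => j _; apply/eqP.
rewrite scaler_eq0; apply/orP; left; apply: contraNT a0 => bj; apply/eqP.
rewrite (coord_vbasis (memvf a)) big1 // => i _.
by have := ab0 i j; rewrite !mxE => /eqP; rewrite mulf_eq0 (negPf bj) orbF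
  => /eqP ->; rewrite scale0r.
Qed.

Lemma tens1_neq0 : tens 1 1 != 0.
Proof. by apply/eqP=> /tens_eq0[] /eqP; rewrite oner_eq0. Qed.

HB.instance Definition _ := GRing.Zmodule_isNzRing.Build tensor
  tmulA tmul1l tmul1r tmulDl tmulDr tens1_neq0.

Fact tensor_scaleAl (c : k) (t u : tensor) : c *: (t * u) = (c *: t) * u.
Proof.
have := tmul_linl u c t 0; rewrite /= addr0 => tmulZ.
rewrite -[RHS]/(tmul (c *: t) u) tmulZ.
by rewrite -[tmul 0 u]/((0 : tensor) * u) mul0r addr0.
Qed.
HB.instance Definition _ :=
  GRing.Lmodule_isLalgebra.Build k tensor tensor_scaleAl.
Fact tensor_scaleAr (c : k) (t u : tensor) : c *: (t * u) = t * (c *: u).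
Proof.
have := tmul_linr t c u 0; rewrite /= addr0 => tmulZ.
rewrite -[RHS]/(tmul t (c *: u)) tmulZ.
by rewrite -[tmul t 0]/(t * (0 : tensor)) mulr0 addr0.
Qed.
HB.instance Definition _ :=
  GRing.Lalgebra_isAlgebra.Build k tensor tensor_scaleAr.
HB.instance Definition _ := Algebra_isFalgebra.Build k tensor.

Lemma tensME a b c d : tens a b * tens c d = tens (a * c) (b * d).
Proof. exact: tensM. Qed.

End Tensor.

(* L (x) L^op : left modules over it are the L-bimodules, where
   (a (x) b) acts by x |-> a x b. *)
Definition envalg (k : fieldType) (L : falgType k) : falgType k :=
  tensor L L^c.

(* Left A-modules; right A-modules are left modules over the converse
   algebra A^c. *)
Record fdmod (k : fieldType) (A : falgType k) := FdMod {
  carrier :> vectType k;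
  act : A -> 'End(carrier);
  act_linear : linear act;
  act1 : act 1 = \1%VF;
  actM : forall a b, act (a * b) = (act a \o act b)%VF }.

Section Modules.
Variables (k : fieldType) (A : falgType k).
Implicit Types M N P Q : fdmod A.

Lemma actME M a b x : act M (a * b) x = act M a (act M b x).
Proof. by rewrite actM comp_lfunE. Qed.

(* Hom_A(M, N) as a subspace of Hom_k(M, N), see [mem_homA] *)
Definition homA M N : {vspace 'Hom(M, N)} :=
  (\bigcap_(i < \dim {:A})
     lker (linfun (fun f : 'Hom(M, N) =>
       (f \o act M (vbasis {:A})`_i)%VF - (act N (vbasis {:A})`_i \o f)%VF)))%VS.

Lemma mem_homA M N (f : 'Hom(M, N)) :
  f \in homA M N <-> forall a x, f (act M a x) = act N a (f x).
Proof.
have lin a : linear (fun f : 'Hom(M, N) => (f \o act M a)%VF - (act N a \o f)%VF).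
  move=> c g h /=; rewrite comp_lfunDl comp_lfunDr -comp_lfunZl -comp_lfunZr.
  by rewrite scalerBr opprD addrACA.
split=> [fH a x | fH].
  have fb i : f (act M (vbasis {:A})`_i x) = act N (vbasis {:A})`_i (f x).
    have : f \in lker (linfun (fun f : 'Hom(M, N) =>
       (f \o act M (vbasis {:A})`_i)%VF - (act N (vbasis {:A})`_i \o f)%VF)).
      case: (ltnP i (\dim {:A})) => [ltid | leid].
        have /subv_bigcapP/(_ (Ordinal ltid) isT) := subvv (homA M N).
        by move/subvP/(_ _ fH).
      rewrite memv_ker linfunE // nth_default ?size_tuple //.
      have a0 (Q : fdmod A) : act Q 0 = 0.
        have := act_linear Q 1 0 0; rewrite scaler0 addr0 scale1r => /esym/eqP.
        by rewrite -subr_eq0 addrK => /eqP.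
      by rewrite !a0 comp_lfun0r comp_lfun0l subr0.
    rewrite memv_ker linfunE // => /eqP/lfunP/(_ x).
    rewrite add_lfunE opp_lfunE !comp_lfunE zero_lfunE => /eqP.
    by rewrite subr_eq0 => /eqP.
  rewrite (coord_vbasis (memvf a)) !(linear_sumE _ _ (@act_linear _ _ _)).
  rewrite !sum_lfunE linear_sum; apply: eq_bigr => i _.
  by rewrite !scale_lfunE linearZ /= fb.
rewrite memvE; apply/subv_bigcapP => i _; rewrite -memvE memv_ker linfunE //.
rewrite subr_eq0; apply/eqP/lfunP=> x; by rewrite !comp_lfunE fH.
Qed.

Lemma homA_comp M N P (g : 'Hom(N, P)) (f : 'Hom(M, N)) :
  g \in homA N P -> f \in homA M N -> (g \o f)%VF \in homA M P.
Proof.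
move=> /mem_homA gH /mem_homA fH; apply/mem_homA=> a x.
by rewrite !comp_lfunE fH gH.
Qed.

Lemma homA_id M : \1%VF \in homA M M.
Proof. by apply/mem_homA=> a x; rewrite !id_lfunE. Qed.

Definition regmod_act (a : A) : 'End(A) := amull a.
Fact regmodM a b : regmod_act (a * b) = (regmod_act a \o regmod_act b)%VF.
Proof. by apply/lfunP=> x; rewrite comp_lfunE !lfunE /= mulrA. Qed.
Definition regmod : fdmod A :=
  @FdMod k A A regmod_act (@amull_is_linear k A) (amull1 A) regmodM.

Definition is_submod M (U : {vspace M}) : Prop :=
  forall a x, x \in U -> act M a x \in U.

Section Sub.
Variables (M : fdmod A) (U : {vspace M}) (HU : is_submod U).

Definition sub_incl : 'Hom(subvs_of U, M) := linfun vsval.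
Definition sub_act (a : A) : 'End(subvs_of U) :=
  (linfun (vsproj U) \o act M a \o sub_incl)%VF.

Lemma sub_actE a x : vsval (sub_act a x) = act M a (vsval x).
Proof. by rewrite !comp_lfunE !lfunE /= vsprojK // HU // subvsP. Qed.

Fact sub_act_linear : linear sub_act.
Proof.
move=> c a b; apply/lfunP=> x; apply: subvs_inj.
by rewrite add_lfunE scale_lfunE linearP /= !sub_actE act_linear
   add_lfunE scale_lfunE.
Qed.
Fact sub_act1 : sub_act 1 = \1%VF.
Proof. by apply/lfunP=> x; apply: subvs_inj; rewrite sub_actE act1 !id_lfunE. Qed.
Fact sub_actM a b : sub_act (a * b) = (sub_act a \o sub_act b)%VF.
Proof.
by apply/lfunP=> x; apply: subvs_inj; rewrite comp_lfunE !sub_actE actME.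
Qed.
Definition submod : fdmod A := FdMod sub_act_linear sub_act1 sub_actM.

Lemma sub_incl_homA : sub_incl \in homA submod M.
Proof. by apply/mem_homA=> a x; rewrite ![sub_incl _]lfunE /= sub_actE. Qed.

(* The quotient M/U is realised on the complement of U. *)
Definition quot_proj : 'Hom(M, subvs_of U^C) :=
  (linfun (vsproj U^C) \o daddv_pi U^C U)%VF.
Definition quot_act (a : A) : 'End(subvs_of U^C) :=
  (quot_proj \o act M a \o linfun vsval)%VF.

Lemma quot_proj_val x : quot_proj (vsval x) = x.
Proof.
rewrite comp_lfunE lfunE /= daddv_pi_id ?vsvalK ?subvsP //.
by rewrite capvC capv_compl.
Qed.

Lemma lker_quot_proj : lker quot_proj = U.
Proof.
have dxU : (U^C :&: U = 0)%VS by rewrite capvC capv_compl.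
apply/vspaceP=> x; rewrite memv_ker comp_lfunE lfunE /=.
have xC : x \in (U^C + U)%VS by rewrite addvC addv_complf memvf.
have xE := daddv_pi_add dxU xC.
apply/eqP/idP => [/(congr1 vsval)|xU].
  by rewrite vsprojK ?memv_pi // linear0 => h; rewrite -xE h add0r memv_pi.
suff -> : daddv_pi U^C U x = 0 by rewrite linear0.
move/eqP: xE; rewrite [daddv_pi U _ x]daddv_pi_id ?capv_compl //.
by rewrite -subr_eq0 addrK => /eqP.
Qed.

Lemma quot_proj_eq0 x : (quot_proj x == 0) = (x \in U).
Proof. by rewrite -memv_ker lker_quot_proj. Qed.

Lemma limg_quot_proj : limg quot_proj = fullv.
Proof.
apply/vspaceP=> x; rewrite memvf -(quot_proj_val x).
by rewrite memv_img ?memvf.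
Qed.

Lemma quot_actE a x : quot_act a (quot_proj x) = quot_proj (act M a x).
Proof.
have -> : quot_act a (quot_proj x) = quot_proj (act M a (vsval (quot_proj x))).
  rewrite [quot_act a]/quot_act; move: quot_proj => q.
  by rewrite comp_lfunE comp_lfunE lfunE.
have dU : vsval (quot_proj x) - x \in U.
  by rewrite -quot_proj_eq0 linearB /= quot_proj_val subrr.
have := HU a dU; rewrite -quot_proj_eq0 !linearB /= subr_eq0.
by move/eqP.
Qed.

Lemma quot_projP y : exists x, y = quot_proj x.
Proof. by exists (vsval y); rewrite quot_proj_val. Qed.

Fact quot_act_linear : linear quot_act.
Proof.
move=> c a b; apply/lfunP=> y; have [x ->] := quot_projP y.
by rewrite add_lfunE scale_lfunE !quot_actE act_linear add_lfunE scale_lfunE linearP.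
Qed.
Fact quot_act1 : quot_act 1 = \1%VF.
Proof.
by apply/lfunP=> y; have [x ->] := quot_projP y; rewrite quot_actE act1 !id_lfunE.
Qed.
Fact quot_actM a b : quot_act (a * b) = (quot_act a \o quot_act b)%VF.
Proof.
apply/lfunP=> y; have [x ->] := quot_projP y.
by rewrite comp_lfunE !quot_actE actME.
Qed.
Definition quotmod : fdmod A := FdMod quot_act_linear quot_act1 quot_actM.

Lemma quot_proj_homA : quot_proj \in homA M quotmod.
Proof. by apply/mem_homA=> a x; rewrite /= quot_actE. Qed.
End Sub.

Lemma lker_submod M N (f : 'Hom(M, N)) : f \in homA M N -> is_submod (lker f).
Proof.
by move=> /mem_homA fH a x; rewrite !memv_ker fH => /eqP ->; rewrite linear0.
Qed.

Lemma limg_submod M N (f : 'Hom(M, N)) : f \in homA M N -> is_submod (limg f).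
Proof.
move=> /mem_homA fH a _ /memv_imgP[x _ ->].
by rewrite -fH memv_img ?memvf.
Qed.

Definition projective P : Prop :=
  forall M N (g : 'Hom(M, N)) (f : 'Hom(P, N)),
    g \in homA M N -> limg g = fullv -> f \in homA P N ->
  exists2 h : 'Hom(P, M), h \in homA P M & (g \o h)%VF = f.

(* M has a projective resolution 0 -> P_n -> ... -> P_0 -> M -> 0 *)
Definition proj_dim_le (n : nat) M : Prop :=
  exists (P : nat -> fdmod A) (d : forall i, 'Hom(P i.+1, P i))
         (e : 'Hom(P 0%N, M)),
  [/\ (forall i, projective (P i)) /\
      (forall i, (n < i)%N -> \dim {:P i} = 0%N),
      e \in homA (P 0%N) M /\ (forall i, d i \in homA (P i.+1) (P i)),
      limg e = fullv, limg (d 0%N) = lker e &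
      forall i, limg (d i.+1) = lker (d i)].

(* The supremum of the projective dimensions of the A-modules is finite and
   equal to d. *)
Definition has_global_dim (d : nat) : Prop :=
  (forall M, proj_dim_le d M) /\
  (forall e, (forall M, proj_dim_le e M) -> (d <= e)%N).

Definition superfluous P (U : {vspace P}) : Prop :=
  forall W : {vspace P}, is_submod W -> (W + U)%VS = fullv -> W = fullv.

Record projcover M := ProjCover {
  pc_mod : fdmod A;
  pc_map : 'Hom(pc_mod, M);
  pc_proj : projective pc_mod;
  pc_homA : pc_map \in homA pc_mod M;
  pc_surj : limg pc_map = fullv;
  pc_min : superfluous (lker pc_map) }.

Section Free.
Variable n : nat.
Definition free_act (a : A) : 'End({ffun 'I_n -> A}) :=
  linfun (fun f : {ffun 'I_n -> A} => [ffun i => a * f i]).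
Lemma free_actE a f i : free_act a f i = a * f i.
Proof.
rewrite linfunE ?ffunE // => c g h; apply/ffunP=> j.
by rewrite !ffunE mulrDr -scalerAr.
Qed.
Fact free_act_linear : linear free_act.
Proof.
move=> c a b; apply/lfunP=> f; apply/ffunP=> i.
by rewrite add_lfunE scale_lfunE !ffunE !free_actE mulrDl -scalerAl.
Qed.
Fact free_act1 : free_act 1 = \1%VF.
Proof. by apply/lfunP=> f; apply/ffunP=> i; rewrite free_actE mul1r id_lfunE. Qed.
Fact free_actM a b : free_act (a * b) = (free_act a \o free_act b)%VF.
Proof.
by apply/lfunP=> f; apply/ffunP=> i; rewrite comp_lfunE !free_actE mulrA.
Qed.
Definition freemod : fdmod A := FdMod free_act_linear free_act1 free_actM.

Definition free_map M (m : 'I_n -> M) : 'Hom({ffun 'I_n -> A}, M) :=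
  linfun (fun f : {ffun 'I_n -> A} => \sum_i act M (f i) (m i)).
Lemma free_mapE M m f : @free_map M m f = \sum_i act M (f i) (m i).
Proof.
rewrite linfunE // => c g h; rewrite scaler_sumr -big_split; apply: eq_bigr => i _.
by rewrite !ffunE act_linear add_lfunE scale_lfunE.
Qed.
Lemma free_map_homA M m : @free_map M m \in homA freemod M.
Proof.
apply/mem_homA=> a x; rewrite !free_mapE linear_sum; apply: eq_bigr => i _.
by rewrite free_actE actME.
Qed.
Definition free_gen i : {ffun 'I_n -> A} := [ffun j => (i == j)%:R].
Lemma free_map_gen M m i : @free_map M m (free_gen i) = m i.
Proof.
rewrite free_mapE (bigD1 i) //= ffunE eqxx act1 id_lfunE big1 ?addr0 // => j ji.
rewrite ffunE eq_sym (negPf ji) /=.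
have := act_linear M 1 0 0; rewrite scaler0 addr0 scale1r => /esym/eqP.
by rewrite -subr_eq0 addrK => /eqP ->; rewrite zero_lfunE.
Qed.
Lemma free_map_uniq M (f : 'Hom({ffun 'I_n -> A}, M)) :
  f \in homA freemod M -> f = @free_map M (fun i => f (free_gen i)).
Proof.
move=> /mem_homA fH; apply/lfunP=> x; rewrite free_mapE.
have {1}-> : x = \sum_i free_act (x i) (free_gen i).
  apply/ffunP=> j; rewrite sum_ffunE (bigD1 j) //= free_actE ffunE eqxx mulr1.
  rewrite big1 ?addr0 // => i ij.
  by rewrite free_actE ffunE (negPf ij) mulr0.
by rewrite linear_sum; apply: eq_bigr => i _; rewrite -fH.
Qed.

Lemma freemod_proj : projective freemod.
Proof.
move=> M N g f gH gS fH.
have pre i : exists x, g x = f (free_gen i).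
  have : f (free_gen i) \in limg g by rewrite gS memvf.
  by case/memv_imgP=> x _ ->; exists x.
pose m i := sval (cid (pre i)).
exists (free_map m); first exact: free_map_homA.
rewrite (free_map_uniq fH) (@free_map_uniq _ (g \o free_map m)%VF).
  congr free_map; apply/funext=> i; rewrite comp_lfunE free_map_gen.
  exact: svalP (cid (pre i)).
exact: homA_comp gH (free_map_homA _).
Qed.
End Free.

Lemma projcover_exists M : inhabited (projcover M).
Proof.
pose n := \dim {:M}; pose F := freemod n.
pose p : 'Hom(F, M) := @free_map n M (fun i => (vbasis {:M})`_i).
have pH : p \in homA F M by apply: free_map_homA.
have pS : limg p = fullv.
  apply/eqP; rewrite eqEsubv subvf -[X in (X <= _)%VS](span_basis (vbasisP _)) /=.
  apply/span_subvP=> x /(nthP 0)[i]; rewrite size_tuple => ilt <-.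
  have <- : p (free_gen (Ordinal ilt)) = (vbasis {:M})`_i by apply: free_map_gen.
  by rewrite memv_img ?memvf.
have FP : projective F by apply: freemod_proj.
pose S (f : 'End(F)) := f \in homA F F /\ (p \o f)%VF = p.
have exr : exists r, `[< exists2 f, S f & \dim (limg f) = r >].
  exists (\dim (limg (\1%VF : 'End(F)))); apply/asboolP; exists \1%VF => //.
  by split; [apply: homA_id | rewrite comp_lfun1r].
case: (ex_minnP exr) => {exr} r /asboolP[f [fH pf] fr] rmin.
have {fr}fmin g : S g -> (\dim (limg f) <= \dim (limg g))%N.
  by move=> Sg; rewrite fr; apply: rmin; apply/asboolP; exists g.
clear rmin.
have ffker : (limg f :&: lker f = 0)%VS.
  apply/eqP; rewrite -dimv_eq0.
  have := limg_ker_dim f (limg f); rewrite -limg_comp.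
  have : (\dim (limg f) <= \dim (limg (f \o f)%VF))%N.
    by apply: fmin; split; [apply: homA_comp | rewrite comp_lfunA !pf].
  move=> le1 E; move: le1; rewrite -E -[X in (_ <= X)%N]add0n leq_add2r leqn0.
  by [].
have HQ := limg_submod fH; pose Q := submod HQ.
pose inc : 'Hom(Q, F) := sub_incl (limg f).
have incH : inc \in homA Q F by apply: sub_incl_homA.
have incE x : inc x = vsval x by rewrite lfunE.
pose f' : 'Hom(F, Q) := (linfun (vsproj (limg f)) \o f)%VF.
have f'E x : vsval (f' x) = f x.
  by rewrite comp_lfunE lfunE /= vsprojK // memv_img ?memvf.
have f'H : f' \in homA F Q.
  have QE a y : vsval (act Q a y) = act F a (vsval y) by apply: sub_actE.
  apply/mem_homA=> a x; apply: subvs_inj; rewrite f'E QE f'E.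
  by move/mem_homA: fH.
pose u : 'End(Q) := (f' \o inc)%VF.
have uH : u \in homA Q Q by apply: homA_comp.
have uker : lker u == 0%VS.
  have uE x : vsval (u x) = f (vsval x).
    transitivity (vsval (f' (inc x))); last by rewrite f'E incE.
    by congr (vsval _); apply: comp_lfunE.
  apply/lker0P=> x y /(congr1 vsval); rewrite !uE => /eqP.
  rewrite -subr_eq0 -linearB => fxy.
  apply: subvs_inj; apply/eqP; rewrite -subr_eq0 -memv0 -ffker memv_cap.
  by rewrite memvB ?subvsP //= memv_ker.
have viH : (u^-1)%VF \in homA Q Q.
  move/mem_homA: uH => uH; apply/mem_homA=> a x.
  by rewrite -{1}[x](lker0_lfunVK uker) -uH lker0_lfunK.
have QP : projective Q.
  move=> N N' g h gH gS hH.
  have [l lH gl] := FP _ _ g (h \o f')%VF gH gS (homA_comp hH f'H).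
  exists (l \o inc \o u^-1)%VF; first by do 2!apply: homA_comp => //.
  rewrite -comp_lfunA comp_lfunA gl -comp_lfunA [(f' \o _)%VF]comp_lfunA.
  by rewrite -/u lker0_compfV // comp_lfun1r.
pose q : 'Hom(Q, M) := (p \o inc)%VF.
have qH : q \in homA Q M by apply: homA_comp.
have qS : limg q = fullv.
  apply/vspaceP=> x; rewrite memvf.
  have : x \in limg p by rewrite pS memvf.
  case/memv_imgP=> y _ ->; rewrite -pf comp_lfunE -f'E -incE -comp_lfunE.
  by rewrite memv_img ?memvf.
split; apply: (@ProjCover M Q q QP qH qS) => W HW WK.
pose V := submod HW; pose j : 'Hom(V, Q) := sub_incl W.
have jH : j \in homA V Q by apply: sub_incl_homA.
have qjS : limg (q \o j)%VF = fullv.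
  apply/vspaceP=> x; rewrite memvf.
  have : x \in limg q by rewrite qS memvf.
  case/memv_imgP=> y _ ->; have : y \in (W + lker q)%VS by rewrite WK memvf.
  case/memv_addP=> w wW [z zK ->]; rewrite linearD /=.
  move: zK; rewrite memv_ker => /eqP ->; rewrite addr0.
  have -> : w = j (vsproj W w) by rewrite lfunE /= vsprojK.
  by rewrite -comp_lfunE memv_img ?memvf.
have [h hH qh] := FP _ _ (q \o j)%VF p (homA_comp qH jH) qjS pH.
have le1 : (\dim (limg f) <= \dim (limg (inc \o j \o h)%VF))%N.
  apply: fmin; split; last by rewrite !comp_lfunA.
  by do 2!apply: homA_comp => //.
have le2 : (\dim (limg (inc \o j \o h)%VF) <= \dim (inc @: W))%N.
  apply: dimvS; apply/subvP=> _ /memv_imgP[x _ ->]; rewrite !comp_lfunE.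
  by rewrite memv_img // lfunE /= subvsP.
have le3 : (\dim (inc @: W) <= \dim W)%N.
  by rewrite -[X in (_ <= X)%N](limg_ker_dim inc) leq_addl.
apply/eqP; rewrite eqEdim subvf dimvf /=.
exact: leq_trans le1 (leq_trans le2 le3).
Qed.

(* Projective covers are unique up to isomorphism; one is chosen for each M. *)
Definition proj_cover M : projcover M :=
  sval (cid (let: inhabits c := projcover_exists M in ex_intro (fun=> True) c I)).

Definition cov0 M : fdmod A := pc_mod (proj_cover M).
Definition cov0_map M : 'Hom(cov0 M, M) := pc_map (proj_cover M).
Definition syz M : fdmod A := submod (lker_submod (pc_homA (proj_cover M))).
Definition omega (n : nat) M : fdmod A := iter n syz M.

(* cov1 M -> cov0 M -> M -> 0 is a minimal projective presentation. *)
Definition cov1 M : fdmod A := cov0 (syz M).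
Definition pres_map M : 'Hom(cov1 M, cov0 M) :=
  (sub_incl (lker (cov0_map M)) \o cov0_map (syz M))%VF.
Lemma pres_map_homA M : pres_map M \in homA (cov1 M) (cov0 M).
Proof. exact: homA_comp (sub_incl_homA _) (pc_homA _). Qed.

End Modules.
Arguments regmod {k} A.
Arguments has_global_dim {k} A d.

Section Translate.
Variables (k : fieldType) (A : falgType k).
Implicit Types M P Q : fdmod A.

(* Hom_A(P, A) as a right A-module: (f a)(x) = f(x) a *)
Section HomReg.
Variable P : fdmod A.

Definition homreg_act (a : A^c) : 'End(subvs_of (homA P (regmod A))) :=
  linfun (fun f : subvs_of (homA P (regmod A)) =>
            vsproj (homA P (regmod A)) (amulr (a : A) \o vsval f)%VF).

Lemma homreg_actE a f x : vsval (homreg_act a f) x = vsval f x * (a : A).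
Proof.
rewrite linfunE => [|c g h].
  rewrite vsprojK ?comp_lfunE ?lfunE //.
  apply/mem_homA=> b y; rewrite !comp_lfunE !lfunE /=.
  by have /mem_homA -> := subvsP f; rewrite lfunE /= mulrA.
by rewrite linearP /= comp_lfunDr -comp_lfunZr linearP.
Qed.

Fact homreg_linear : linear homreg_act.
Proof.
move=> c a b; apply/lfunP=> f; apply/subvs_inj/lfunP=> x.
by rewrite add_lfunE scale_lfunE linearP /= add_lfunE scale_lfunE !homreg_actE
           mulrDr -scalerAr.
Qed.
Fact homreg1 : homreg_act 1 = \1%VF.
Proof.
by apply/lfunP=> f; apply/subvs_inj/lfunP=> x; rewrite homreg_actE mulr1 id_lfunE.
Qed.
Fact homregM (a b : A^c) : homreg_act (a * b) = (homreg_act a \o homreg_act b)%VF.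
Proof.
apply/lfunP=> f; apply/subvs_inj/lfunP=> x.
by rewrite comp_lfunE !homreg_actE -mulrA.
Qed.
Definition homreg : fdmod A^c := FdMod homreg_linear homreg1 homregM.
End HomReg.

(* The map g |-> g o d from Hom_A(Q, A) to Hom_A(P, A); for A-linear d the
   projection vsproj acts as the identity, see [homreg_mapE]. *)
Definition homreg_map P Q (d : 'Hom(P, Q)) : 'Hom(homreg Q, homreg P) :=
  linfun (fun g : subvs_of (homA Q (regmod A)) =>
            vsproj (homA P (regmod A)) (vsval g \o d)%VF).

Lemma homreg_mapE P Q (d : 'Hom(P, Q)) g x :
  d \in homA P Q -> vsval (homreg_map d g) x = vsval g (d x).
Proof.
move=> dH; rewrite linfunE => [|c f h]; last first.
  by rewrite linearP /= comp_lfunDl -comp_lfunZl linearP.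
by rewrite vsprojK ?comp_lfunE // homA_comp // subvsP.
Qed.

Lemma homreg_map_homA P Q (d : 'Hom(P, Q)) :
  d \in homA P Q -> homreg_map d \in homA (homreg Q) (homreg P).
Proof.
move=> dH; apply/mem_homA=> a g; apply/subvs_inj/lfunP=> x.
rewrite homreg_mapE //.
transitivity (vsval g (d x) * a); first exact: homreg_actE.
by rewrite -(homreg_mapE g x dH); apply/esym/homreg_actE.
Qed.

(* The transpose, i.e. the cokernel of Hom(P_0, A) -> Hom(P_1, A). *)
Definition tr M : fdmod A^c :=
  quotmod (limg_submod (homreg_map_homA (pres_map_homA M))).

(* D = Hom_k(-, k), from right to left modules: (a f)(x) = f(x a) *)
Section DualRight.
Variable T : fdmod A^c.

Definition dual_act (a : A) : 'End('Hom(T, k^o)) :=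
  linfun (fun f : 'Hom(T, k^o) => (f \o act T a)%VF).
Lemma dual_actE a f x : dual_act a f x = f (act T a x).
Proof.
rewrite linfunE ?comp_lfunE // => c g h.
by rewrite comp_lfunDl -comp_lfunZl.
Qed.
Fact dual_linear : linear dual_act.
Proof.
move=> c a b; apply/lfunP=> f; apply/lfunP=> x.
rewrite add_lfunE scale_lfunE add_lfunE scale_lfunE !dual_actE.
by rewrite (act_linear T c a b) add_lfunE scale_lfunE linearP.
Qed.
Fact dual1 : dual_act 1 = \1%VF.
Proof.
apply/lfunP=> f; apply/lfunP=> x.
by rewrite dual_actE (act1 T) !id_lfunE.
Qed.
Fact dualM a b : dual_act (a * b) = (dual_act a \o dual_act b)%VF.
Proof.
apply/lfunP=> f; apply/lfunP=> x; rewrite comp_lfunE !dual_actE.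
by congr (f _); apply: (@actME k A^c T b a x).
Qed.
Definition dual_right : fdmod A := FdMod dual_linear dual1 dualM.
End DualRight.

Definition tau M : fdmod A := dual_right (tr M).

(* tau_n = tau Omega^(n-1); only meaningful for n >= 1. *)
Definition tau_n (n : nat) M : fdmod A := tau (omega n.-1 M).

End Translate.

Section Bimodules.
Variables (k : fieldType) (L : falgType k).

Definition bimod := fdmod (envalg L).

Definition regbim_act : envalg L -> 'End(L) :=
  tlift (fun (a : L) (b : L^c) => (amull a \o amulr (b : L))%VF).
Lemma regbim_bilin :
  bilin (fun (a : L) (b : L^c) => (amull a \o amulr (b : L))%VF).
Proof.
split=> [b c a a' | a c b b'] /=.
  by rewrite linearP comp_lfunDl -comp_lfunZl.
by rewrite (@amulr_is_linear k L c b b') comp_lfunDr -comp_lfunZr.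
Qed.
Lemma regbim_actE (a b x : L) : regbim_act (tens a (b : L^c)) x = a * x * b.
Proof.
by rewrite /regbim_act (tliftE _ _ regbim_bilin) comp_lfunE !lfunE /= mulrA.
Qed.
Fact regbim_linear : linear regbim_act.
Proof. exact: tlift_linear. Qed.
Fact regbim1 : regbim_act 1 = \1%VF.
Proof.
by apply/lfunP=> x; rewrite (regbim_actE 1 1 x) mul1r mulr1 id_lfunE.
Qed.
Lemma regbimD t u : regbim_act (t + u) = regbim_act t + regbim_act u.
Proof. by have := regbim_linear 1 t u; rewrite !scale1r. Qed.
Fact regbimM t u : regbim_act (t * u) = (regbim_act t \o regbim_act u)%VF.
Proof.
elim/tensor_ind: t => [a b|t t' IH IH']; last first.
  by rewrite mulrDl !regbimD IH IH' comp_lfunDl.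
elim/tensor_ind: u => [c e|u u' IH IH']; last first.
  by rewrite mulrDr !regbimD IH IH' comp_lfunDr.
apply/lfunP=> x; rewrite comp_lfunE !regbim_actE tensME.
by rewrite (regbim_actE (a * c) ((e : L) * (b : L)) x) !mulrA.
Qed.
Definition regbim : bimod := FdMod regbim_linear regbim1 regbimM.

(* The anti-automorphism a (x) b |-> b (x) a of L (x) L^op, which turns the
   right module D X into a left one: (a f b)(x) = f(b x a). *)
Definition env_swap : envalg L -> envalg L :=
  tlift (fun (a : L) (b : L^c) => tens (b : L) (a : L^c)).
Lemma env_swap_bilin :
  bilin (fun (a : L) (b : L^c) => tens (b : L) (a : L^c)).
Proof.
split=> [b c a a' | a c b b'].
  exact: (@tens_bilin k L L^c).2.
exact: (@tens_bilin k L L^c).1.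
Qed.
Lemma env_swapE (a b : L) : env_swap (tens a (b : L^c)) = tens b (a : L^c).
Proof. by rewrite /env_swap (tliftE _ _ env_swap_bilin). Qed.
Lemma env_swap_linear : linear env_swap.
Proof. exact: tlift_linear. Qed.
Lemma env_swapD t u : env_swap (t + u) = env_swap t + env_swap u.
Proof. by have := env_swap_linear 1 t u; rewrite !scale1r. Qed.
Lemma env_swapM t u : env_swap (t * u) = env_swap u * env_swap t.
Proof.
elim/tensor_ind: t => [a b|t t' IH IH']; last first.
  by rewrite mulrDl !env_swapD mulrDr IH IH'.
elim/tensor_ind: u => [c e|u u' IH IH']; last first.
  by rewrite mulrDr !env_swapD mulrDl IH IH'.
rewrite tensME (env_swapE (a * c) ((e : L) * (b : L))).
by rewrite !env_swapE tensME.
Qed.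

Section DualBim.
Variable X : bimod.

Definition dualbim_act (t : envalg L) : 'End('Hom(X, k^o)) :=
  linfun (fun f : 'Hom(X, k^o) => (f \o act X (env_swap t))%VF).
Lemma dualbim_actE t f x : dualbim_act t f x = f (act X (env_swap t) x).
Proof.
rewrite linfunE ?comp_lfunE // => c g h.
by rewrite comp_lfunDl -comp_lfunZl.
Qed.
Fact dualbim_linear : linear dualbim_act.
Proof.
move=> c t u; apply/lfunP=> f; apply/lfunP=> x.
rewrite add_lfunE scale_lfunE add_lfunE scale_lfunE !dualbim_actE.
by rewrite env_swap_linear act_linear add_lfunE scale_lfunE linearP.
Qed.
Fact dualbim1 : dualbim_act 1 = \1%VF.
Proof.
apply/lfunP=> f; apply/lfunP=> x; rewrite dualbim_actE (env_swapE 1 1).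
by rewrite [act X _]act1 !id_lfunE.
Qed.
Fact dualbimM t u : dualbim_act (t * u) = (dualbim_act t \o dualbim_act u)%VF.
Proof.
apply/lfunP=> f; apply/lfunP=> x; rewrite comp_lfunE !dualbim_actE.
by rewrite env_swapM actME.
Qed.
Definition dualbim : bimod := FdMod dualbim_linear dualbim1 dualbimM.
End DualBim.

Definition maximal_left_ideal (I : {vspace L}) : Prop :=
  [/\ is_submod (M := regmod L) I, I <> fullv &
      forall J : {vspace L}, is_submod (M := regmod L) J -> (I <= J)%VS ->
        J = I \/ J = fullv].

Definition in_jacobson_radical (x : L) : Prop :=
  forall I : {vspace L}, maximal_left_ideal I -> x \in I.

(* HH^n_tau(L, X) = D Hom(X, tau_n L) and HH_n^tau(L, X) = Hom(D X, tau_n L),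
   for n >= 1 *)
Definition HHtau_coh (n : nat) (X : bimod) : vectType k :=
  'Hom(subvs_of (homA X (tau_n n regbim)), k^o).
Definition HHtau_hom (n : nat) (X : bimod) : vectType k :=
  subvs_of (homA (dualbim X) (tau_n n regbim)).

End Bimodules.

(* B is projective as a B-bimodule *)
Definition separable_algebra (k : fieldType) (B : falgType k) : Prop :=
  projective (regbim B).

(* L/rad(L) is separable; the quotient algebra is given by a surjective algebra
   morphism with kernel rad(L). *)
Definition separable_mod_radical (k : fieldType) (L : falgType k) : Prop :=
  exists (B : falgType k) (pi : 'AHom(L, B)),
    [/\ limg pi = fullv,
        forall x, pi x = 0 <-> in_jacobson_radical x &
        separable_algebra B].

(* Main.v *)
Require Import Defs.
From mathcomp Require Import all_boot all_order all_algebra all_field.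
From mathcomp Require Import boolp.

Set Implicit Arguments.
Unset Strict Implicit.
Unset Printing Implicit Defensive.

Import GRing.Theory.
Local Open Scope ring_scope.

(** Write A for the enveloping algebra of L, r for the radical of L and
    B = L/r, so that L-bimodules are A-modules.

    The first half rests on the fact that the projective dimension of L over A
    is at most d, that is, N = Omega^(d+1) L vanishes
    ([omega_succ_gldim_eq0]). If N is not zero, then by Nakayama's lemma
    X = N/rN is not zero either. As r kills X on the left and B is separable, X
    is a direct summand of the bimodule Hom_k(DX, B)
    ([ext1_zero_left_semisimple]). Now Ext_A^1(Omega^d L, Hom_k(W, B)) is zero
    for every left module W: when W is projective, a bimodule map
    P -> Hom_k(W, B) is assembled from left-linear maps P -> B, and Omega^m L is
    projective as a left module ([ext1_zero_homk_projective]); shifting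
    dimensions simultaneously in L and along a projective resolution of W, which
    has length at most d, gives the general case ([ext1_zero_homk]).
    Consequently N -> X extends to the projective cover of Omega^d L, which
    contradicts the minimality of that cover ([ext1_zero_syz_quotient]). Hence
    Omega^(n-1) L is projective for n > d, and tau of it is zero.

    For the last claim put M = Omega^(d-1) L. Its minimal resolution is
    0 -> P_1 -> P_0 -> M -> 0, by the first half, and it splits over L on the
    left, since M is projective as a left module. A bimodule map
    DL -> tau M = D Tr M is in particular linear for one of the two actions of
    L; dualizing, it is a one-sided linear map Tr M -> L, that is, a one-sided
    linear functional phi on Hom_A(P_1, A) that vanishes on the image of
    Hom_A(P_0, A). One-sided functionals on Hom_A(P, A) are the elements of
    DL (x)_L P when P is projective, and DL (x)_L P_1 -> DL (x)_L P_0 is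
    injective because P_1 -> P_0 is split on the left. Hence phi = 0
    ([one_sided_functional_eq0]). *)

(** * Modules, dual bases and projective covers *)

Section ModuleBasics.
Variables (k : fieldType) (A : falgType k).
Implicit Types M N P Q : fdmod A.

Lemma actDl M a b x : act M (a + b) x = act M a x + act M b x.
Proof.
by have := act_linear M 1 a b; rewrite !scale1r => ->; rewrite add_lfunE.
Qed.

Lemma act0l M x : act M 0 x = 0.
Proof. by apply: (addrI (act M 0 x)); rewrite -actDl !addr0. Qed.

Lemma actZl M c a x : act M (c *: a) x = c *: act M a x.
Proof.
have := act_linear M c a 0; rewrite addr0 => ->.
by rewrite add_lfunE scale_lfunE act0l addr0.
Qed.

Lemma act_suml M (I : finType) (a : I -> A) x :
  act M (\sum_i a i) x = \sum_i act M (a i) x.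
Proof.
elim/big_rec2: _ => [|i y b _ <-]; first exact: act0l.
exact: actDl.
Qed.

Lemma act1E M x : act M 1 x = x.
Proof. by rewrite act1 id_lfunE. Qed.

Lemma homAE M N (f : 'Hom(M, N)) a x :
  f \in homA M N -> f (act M a x) = act N a (f x).
Proof. by move/mem_homA. Qed.

Lemma limg_fullP (U V : vectType k) (f : 'Hom(U, V)) :
  limg f = fullv <-> forall y, exists x, f x = y.
Proof.
split=> [fS y | fS].
  have : y \in limg f by rewrite fS memvf.
  by case/memv_imgP=> x _ ->; exists x.
apply/vspaceP=> y; rewrite memvf; have [x <-] := fS y.
by rewrite memv_img ?memvf.
Qed.

Lemma act_regmod (a x : A) : act (regmod A) a x = a * x.
Proof. exact: lfunE. Qed.

(** In a dual basis, the extensions and the one-sided functionals constructed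
    below have explicit formulas. *)
Definition dual_basis P : Prop :=
  exists (I : finType) (h : I -> 'Hom(P, regmod A)) (y : I -> P),
    (forall i, h i \in homA P (regmod A)) /\
    (forall x, x = \sum_i act P (h i x) (y i)).

Lemma projective_dual_basis P : projective P -> dual_basis P.
Proof.
move=> PP; pose n := \dim {:P}.
pose m (i : 'I_n) : P := (vbasis {:P})`_i.
have pS : limg (free_map (M := P) m) = fullv.
  apply/limg_fullP=> y; rewrite (coord_vbasis (memvf y)).
  exists [ffun i => (coord (vbasis {:P}) i y)%:A].
  rewrite free_mapE; apply: eq_bigr => i _.
  by rewrite ffunE actZl act1E.
have [l lH pl] := PP _ _ _ _ (free_map_homA m) pS (homA_id P).
pose h (i : 'I_n) : 'Hom(P, regmod A) := linfun (fun x : P => l x i : regmod A).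
have hE i x : h i x = l x i.
  by rewrite linfunE // => c u v; rewrite linearP !ffunE.
exists 'I_n, h, m; split=> [i | x].
  by apply/mem_homA=> a x; rewrite !hE (homAE _ _ lH) free_actE act_regmod.
rewrite -{1}[x](id_lfunE) -pl comp_lfunE free_mapE.
by apply: eq_bigr => i _; rewrite hE.
Qed.

Lemma dual_basis_projective P : dual_basis P -> projective P.
Proof.
move=> [I [h [y [hH Pxy]]]] M N g f gH gS fH.
have pre i : exists x, g x = f (y i) by move/limg_fullP: gS; apply.
pose m i := sval (cid (pre i)).
have mE i : g (m i) = f (y i) := svalP (cid (pre i)).
pose l : 'Hom(P, M) := linfun (fun x : P => \sum_i act M (h i x) (m i)).
have lE x : l x = \sum_i act M (h i x) (m i).
  rewrite linfunE // => c u v; rewrite scaler_sumr -big_split /=.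
  by apply: eq_bigr => i _; rewrite linearP actDl actZl.
exists l.
  apply/mem_homA=> a x; rewrite !lE linear_sum; apply: eq_bigr => i _.
  by rewrite (homAE _ _ (hH i)) act_regmod actME.
apply/lfunP=> x; rewrite comp_lfunE lE linear_sum [in RHS](Pxy x) linear_sum.
by apply: eq_bigr => i _; rewrite /= (homAE _ _ gH) mE (homAE _ _ fH).
Qed.

Lemma projective_retract P Q (i : 'Hom(Q, P)) (s : 'Hom(P, Q)) :
  i \in homA Q P -> s \in homA P Q -> (forall x, s (i x) = x) ->
  projective P -> projective Q.
Proof.
move=> iH sH si PP M N g f gH gS fH.
have [l lH gl] := PP _ _ g (f \o s)%VF gH gS (homA_comp fH sH).
exists (l \o i)%VF; first exact: homA_comp.
by apply/lfunP=> x; rewrite comp_lfunA gl !comp_lfunE si.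
Qed.

Lemma cov0_projective M : projective (cov0 M).
Proof. exact: pc_proj. Qed.

Lemma syz_actE M a (z : syz M) :
  vsval (act (syz M) a z) = act (cov0 M) a (vsval z).
Proof. exact: (sub_actE (lker_submod (pc_homA (proj_cover M)))). Qed.

Lemma syz_exact M x : (cov0_map M x = 0) <-> exists z : syz M, x = vsval z.
Proof.
split=> [x0 | [z ->]]; last by apply/eqP; rewrite -memv_ker subvsP.
by exists (vsproj _ x); rewrite vsprojK // memv_ker x0.
Qed.

End ModuleBasics.

(** * Coordinates in the enveloping algebra *)

Section EnvelopingAlgebra.
Variables (k : fieldType) (L : falgType k).
Local Notation A := (envalg L).

Lemma homA_tens (M N : fdmod A) (f : 'Hom(M, N)) :
  (forall a b x, f (act M (tens a b) x) = act N (tens a b) (f x)) ->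
  f \in homA M N.
Proof.
move=> fH; apply/mem_homA=> t x; elim/tensor_ind: t => // t u IH IH'.
by rewrite !actDl linearD /= IH IH'.
Qed.

(** Writing t in A as the sum of the c_j (x) e_j, with (e_j) the chosen basis of
    the second factor, [col_coef j t] is c_j; [row_coef] is the same thing for a
    basis of the first factor. They turn a bimodule coordinate with values in A
    into one-sided coordinates with values in the base algebra. *)
Definition col_coef (j : 'I_(\dim {:L^c})) (t : A) : L :=
  \sum_i t i j *: (vbasis {:L})`_i.

Lemma col_coef_tens j (a : L) (b : L^c) :
  col_coef j (tens a b) = coord (vbasis {:L^c}) j b *: a.
Proof.
rewrite [a in RHS](coord_vbasis (memvf a)) scaler_sumr.
by apply: eq_bigr => i _; rewrite mxE scalerA mulrC.
Qed.

Lemma col_coef_linear j : linear (col_coef j).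
Proof.
move=> c t u; rewrite /col_coef scaler_sumr -big_split /=.
by apply: eq_bigr => i _; rewrite !mxE scalerA scalerDl.
Qed.

Lemma col_coefD j t u : col_coef j (t + u) = col_coef j t + col_coef j u.
Proof. by have := col_coef_linear j 1 t u; rewrite !scale1r. Qed.

Lemma col_coef_sum (t : A) :
  t = \sum_j tens (col_coef j t) (vbasis {:L^c})`_j.
Proof.
rewrite {1}(tensor_sum t) exchange_big; apply: eq_bigr => j _ /=.
by rewrite /col_coef (linear_sumE _ _ ((tens_bilin _ _).1 _)).
Qed.

Lemma col_coefM j (a : L) (t : A) :
  col_coef j (tens a (1 : L^c) * t) = a * col_coef j t.
Proof.
elim/tensor_ind: t => [b c|t u IH IH'].
  by rewrite tensME !col_coef_tens mul1r scalerAr.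
by rewrite mulrDr !col_coefD IH IH' mulrDr.
Qed.

Definition row_coef (i : 'I_(\dim {:L})) (t : A) : L^c :=
  \sum_j t i j *: (vbasis {:L^c})`_j.

Lemma row_coef_tens i (a : L) (b : L^c) :
  row_coef i (tens a b) = coord (vbasis {:L}) i a *: b.
Proof.
rewrite [b in RHS](coord_vbasis (memvf b)) scaler_sumr.
by apply: eq_bigr => j _; rewrite mxE scalerA.
Qed.

Lemma row_coefD i t u : row_coef i (t + u) = row_coef i t + row_coef i u.
Proof.
by rewrite /row_coef -big_split; apply: eq_bigr => j _; rewrite mxE scalerDl.
Qed.

Lemma col_coefMr j (t : A) (a : L) :
  col_coef j (t * tens a (1 : L^c)) = col_coef j t * a.
Proof.
elim/tensor_ind: t => [b c|t u IH IH'].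
  by rewrite tensME !col_coef_tens mulr1 scalerAl.
by rewrite mulrDl !col_coefD IH IH' mulrDl.
Qed.

Lemma row_coef_sum (t : A) :
  t = \sum_(i < \dim {:L}) tens (vbasis {:L})`_i (row_coef i t).
Proof.
rewrite {1}(tensor_sum t); apply: eq_bigr => i _.
by rewrite /row_coef (linear_sumE _ _ ((tens_bilin _ _).2 _)).
Qed.

Lemma row_coefM i (c : L^c) (t : A) :
  row_coef i (tens 1 c * t) = c * row_coef i t.
Proof.
elim/tensor_ind: t => [a b|t u IH IH'].
  by rewrite tensME !row_coef_tens mul1r scalerAr.
by rewrite mulrDr !row_coefD IH IH' mulrDr.
Qed.

Lemma coord_row_coef i j (t : A) :
  coord (vbasis {:L^c}) j (row_coef i t) = t i j.
Proof. by rewrite coord_sum_free ?(basis_free (vbasisP _)). Qed.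

Lemma coord_col_coef i j (t : A) :
  coord (vbasis {:L}) i (col_coef j t) = t i j.
Proof.
by rewrite (coord_sum_free (fun i => t i j)) ?(basis_free (vbasisP _)).
Qed.

End EnvelopingAlgebra.

(** * Bimodules as left modules *)

Section LeftRestriction.
Variables (k : fieldType) (L : falgType k).
Local Notation A := (envalg L).

Section Def.
Variable M : fdmod A.
Definition lres_act (a : L) : 'End(M) := act M (tens a (1 : L^c)).
Fact lres_linear : linear lres_act.
Proof.
by move=> c a b; rewrite /lres_act (tens_bilin _ _).1 act_linear.
Qed.
Fact lres1 : lres_act 1 = \1%VF.
Proof. exact: (act1 M). Qed.
Fact lresM a b : lres_act (a * b) = (lres_act a \o lres_act b)%VF.
Proof. by rewrite /lres_act -actM tensME mulr1. Qed.
Definition lres : fdmod L := FdMod lres_linear lres1 lresM.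
End Def.

Lemma lres_homA (M N : fdmod A) (f : 'Hom(M, N)) :
  f \in homA M N -> f \in homA (lres M) (lres N).
Proof. by move=> /mem_homA fH; apply/mem_homA=> a x; apply: fH. Qed.

(** A is free as a left L-module, so each coordinate of P with values in A splits
    into as many coordinates with values in L as L has dimensions. *)
Lemma lres_projective (P : fdmod A) : projective P -> projective (lres P).
Proof.
move=> /projective_dual_basis [I [h [y [hH Pxy]]]].
apply: dual_basis_projective.
pose hh (ij : I * 'I_(\dim {:L^c})) : 'Hom(P, L) :=
  linfun (fun x : P => col_coef ij.2 (h ij.1 x)).
have hhE ij x : hh ij x = col_coef ij.2 (h ij.1 x).
  by rewrite linfunE // => c u v; rewrite linearP; apply: col_coef_linear.
exists (I * 'I_(\dim {:L^c}))%type, hh.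
exists (fun ij : I * 'I_(\dim {:L^c}) =>
  act P (tens 1 (vbasis {:L^c})`_(ij.2)) (y ij.1)).
split=> [ij | x].
  apply/mem_homA=> a x; rewrite !hhE lfunE /= -col_coefM.
  by congr col_coef; rewrite [LHS](homAE _ _ (hH _)) lfunE.
rewrite {1}(Pxy x).
rewrite -(pair_bigA _ (fun i j => act (lres P) (hh (i, j) x)
   (act P (tens 1 (vbasis {:L^c})`_j) (y i)))) /=.
apply: eq_bigr => i _; rewrite {1}(col_coef_sum (h i x)) act_suml.
apply: eq_bigr => j _; rewrite hhE /=.
rewrite /lres_act -actME; congr (act P _ _).
by rewrite tensME mul1r mulr1.
Qed.

Lemma lres_regbim_projective : projective (lres (regbim L)).
Proof.
apply: dual_basis_projective.
exists unit, (fun _ => \1%VF), (fun _ => 1); split=> [_ | x].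
  apply/mem_homA=> a x; rewrite !id_lfunE lfunE /=.
  by rewrite [LHS](regbim_actE a 1 x) mulr1.
rewrite big_const card_unit /= addr0 id_lfunE.
by rewrite [RHS](regbim_actE x 1 1) !mulr1.
Qed.

(** Over the base algebra, the projective cover of a left-projective bimodule
    splits, so maps out of its syzygy extend left-linearly. *)
Lemma left_retraction (K : fdmod A) : projective (lres K) ->
  exists2 s : 'Hom(cov0 K, syz K),
    s \in homA (lres (cov0 K)) (lres (syz K)) & forall z, s (vsval z) = z.
Proof.
move=> PK; pose p := cov0_map K.
have pH : p \in homA (cov0 K) K := pc_homA _.
have pS : limg p = fullv := pc_surj _.
have [l lH pl] := PK _ _ _ _ (lres_homA pH) pS (homA_id _).
pose s : 'Hom(cov0 K, syz K) := linfun (fun x => vsproj (lker p) (x - l (p x))).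
have sE x : vsval (s x) = x - l (p x).
  rewrite linfunE ?vsprojK //; last first.
    move=> c u v; rewrite -linearP /=; congr (vsproj _ _).
    have -> : l (p (c *: u + v)) = c *: l (p u) + l (p v) by rewrite !linearP.
    by rewrite scalerBr opprD addrACA.
  rewrite memv_ker linearB /= -[p (l _)]comp_lfunE pl id_lfunE.
  by rewrite subrr.
exists s; last first.
  move=> z; apply: subvs_inj; rewrite sE.
  suff -> : p (vsval z) = 0 by rewrite linear0 subr0.
  by apply/syz_exact; exists z.
apply/mem_homA=> a x; apply: subvs_inj.
transitivity (act (cov0 K) (tens a 1) (vsval (s x))); last first.
  by symmetry; apply: syz_actE.
etransitivity; first exact: sE.
rewrite sE linearB /=; congr (_ - _).
by rewrite [p _](homAE _ _ pH) (homAE _ _ lH).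
Qed.

Lemma lres_syz_projective (K : fdmod A) :
  projective (lres K) -> projective (lres (syz K)).
Proof.
move=> /left_retraction[s sH sK].
have iH := sub_incl_homA (lker_submod (pc_homA (proj_cover K))).
apply: (projective_retract (lres_homA iH) sH) => [z|].
  by rewrite lfunE sK.
by apply: lres_projective; apply: cov0_projective.
Qed.

Lemma lres_omega_projective n : projective (lres (omega n (regbim L))).
Proof.
elim: n => [|n IH]; first exact: lres_regbim_projective.
exact: lres_syz_projective.
Qed.

End LeftRestriction.

(** * Vanishing of Ext^1 *)

Section Ext.
Variables (k : fieldType) (A : falgType k).
Implicit Types K M N P Q Y : fdmod A.

(** Since [cov0 K] is projective, this says that Ext^1(K, Y) = 0. *)
Definition ext1_zero K Y : Prop :=
  forall f : 'Hom(syz K, Y), f \in homA (syz K) Y ->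
  exists2 F : 'Hom(cov0 K, Y), F \in homA (cov0 K) Y &
    forall z : syz K, F (vsval z) = f z.

Lemma cov0_mapS M y : exists x, cov0_map M x = y.
Proof. by move: y; apply/limg_fullP/pc_surj. Qed.

Lemma factor_surj P M Y (p : 'Hom(P, M)) (h : 'Hom(P, Y)) :
  p \in homA P M -> h \in homA P Y -> (forall y, exists x, p x = y) ->
  (forall x, p x = 0 -> h x = 0) ->
  exists2 g : 'Hom(M, Y), g \in homA M Y & forall x, g (p x) = h x.
Proof.
move=> pH hH pS ph.
have gE x : (h \o p^-1)%VF (p x) = h x.
  rewrite comp_lfunE; apply/eqP; rewrite -subr_eq0 -linearB; apply/eqP.
  by apply: ph; rewrite linearB /= limg_lfunVK ?subrr // memv_img ?memvf.
exists (h \o p^-1)%VF => //; apply/mem_homA=> a y; have [x <-] := pS y.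
by rewrite -(homAE _ _ pH) !gE (homAE _ _ hH).
Qed.

Lemma factor_inj P Y Y' (i : 'Hom(Y, Y')) (h : 'Hom(P, Y')) :
  i \in homA Y Y' -> h \in homA P Y' -> injective i ->
  (forall x, exists y, h x = i y) ->
  exists2 g : 'Hom(P, Y), g \in homA P Y & forall x, i (g x) = h x.
Proof.
move=> iH hH iI hi.
have gE x : i ((i^-1 \o h)%VF x) = h x.
  rewrite comp_lfunE; have [y ->] := hi x.
  by rewrite limg_lfunVK // memv_img ?memvf.
exists (i^-1 \o h)%VF => //; apply/mem_homA=> a x; apply: iI.
by rewrite (homAE _ _ iH) !gE (homAE _ _ hH).
Qed.

(** For a short exact sequence 0 -> Y -> Y' -> Y'' -> 0: the group
    Ext^1(syz K, Y) is Ext^2(K, Y), which lies in the long exact sequence between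
    Ext^1(K, Y'') and Ext^2(K, Y') = Ext^1(syz K, Y'). *)
Lemma ext1_zero_shift K Y Y' Y'' (i : 'Hom(Y, Y')) (q : 'Hom(Y', Y'')) :
    i \in homA Y Y' -> q \in homA Y' Y'' -> injective i ->
    (forall y, (q y = 0) <-> exists x, y = i x) -> limg q = fullv ->
  ext1_zero (syz K) Y' -> ext1_zero K Y'' -> ext1_zero (syz K) Y.
Proof.
move=> iH qH iI exq qS E' E'' f fH.
have [F FH Ff] := E' (i \o f)%VF (homA_comp iH fH).
(* q F kills syz (syz K), hence factors through syz K; the lift G of the extended
   factor is the correction that brings F into Y. *)
have [|g gH gF] := factor_surj (p := cov0_map (syz K)) (pc_homA _)
  (homA_comp qH FH) (@cov0_mapS _).
  move=> x /syz_exact[z ->]; rewrite comp_lfunE Ff comp_lfunE.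
  by apply/exq; exists (f z).
have [G0 G0H G0g] := E'' g gH.
have [G GH qG] := cov0_projective qH qS G0H.
have dH := pres_map_homA K.
have [||F' F'H iF'] := factor_inj (h := F - (G \o pres_map K)%VF) iH _ iI.
- exact: memvB FH (homA_comp GH dH).
- move=> x; apply/exq; rewrite add_lfunE opp_lfunE !comp_lfunE linearB /=.
  rewrite -[q (G _)]comp_lfunE qG [sub_incl _ _]lfunE /= G0g.
  by rewrite gF comp_lfunE subrr.
exists F' => // z; apply: iI; rewrite iF' add_lfunE opp_lfunE !comp_lfunE.
rewrite Ff comp_lfunE.
have -> : cov0_map (syz K) (vsval z) = 0 by apply/syz_exact; exists z.
by rewrite !linear0 addr0.
Qed.
End Ext.

(** * Bimodules of k-linear maps between left modules *)

Section HomBimodule.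
Variables (k : fieldType) (L : falgType k).
Local Notation A := (envalg L).

Section Def.
Variables W U : fdmod L.
Definition homk_tens (a : L) (b : L^c) : 'End('Hom(W, U)) :=
  linfun (fun f : 'Hom(W, U) => (act U a \o f \o act W (b : L))%VF).
Lemma homk_tensE a b f w : homk_tens a b f w = act U a (f (act W (b : L) w)).
Proof.
rewrite linfunE ?comp_lfunE // => c g h.
by rewrite comp_lfunDr comp_lfunDl -comp_lfunZr -comp_lfunZl.
Qed.
Lemma homk_bilin : bilin homk_tens.
Proof.
split=> [b c a a' | a c b b'] /=; apply/lfunP=> f; apply/lfunP=> w;
  rewrite add_lfunE scale_lfunE add_lfunE scale_lfunE !homk_tensE.
  by rewrite actDl actZl.
by rewrite (@actDl k L) (@actZl k L) !linearP.
Qed.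
Definition homk_act : A -> 'End('Hom(W, U)) := tlift homk_tens.
Lemma homk_actE (a b : L) f w :
  homk_act (tens a (b : L^c)) f w = act U a (f (act W b w)).
Proof. by rewrite /homk_act (tliftE _ _ homk_bilin) homk_tensE. Qed.
Fact homk_linear : linear homk_act.
Proof. exact: tlift_linear. Qed.
Lemma homkD t u : homk_act (t + u) = homk_act t + homk_act u.
Proof. by have := homk_linear 1 t u; rewrite !scale1r. Qed.
Fact homk1 : homk_act 1 = \1%VF.
Proof.
apply/lfunP=> f; apply/lfunP=> w.
by rewrite (homk_actE 1 1) !act1E id_lfunE.
Qed.
Fact homkM t u : homk_act (t * u) = (homk_act t \o homk_act u)%VF.
Proof.
elim/tensor_ind: t => [a b|t t' IH IH']; last first.
  by rewrite mulrDl !homkD IH IH' comp_lfunDl.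
elim/tensor_ind: u => [c e|u u' IH IH']; last first.
  by rewrite mulrDr !homkD IH IH' comp_lfunDr.
apply/lfunP=> f; apply/lfunP=> w; rewrite comp_lfunE !homk_actE tensME.
by rewrite (homk_actE (a * c) ((e : L) * (b : L))) !actME.
Qed.
Definition homk : bimod L := FdMod homk_linear homk1 homkM.
End Def.

Section Precomp.
Variables (W W' U : fdmod L) (g : 'Hom(W, W')).
Definition homk_map : 'Hom(homk W' U, homk W U) :=
  linfun (fun f : 'Hom(W', U) => (f \o g)%VF : 'Hom(W, U)).
Lemma homk_mapE (f : homk W' U) w :
  (homk_map f : 'Hom(W, U)) w = (f : 'Hom(W', U)) (g w).
Proof.
rewrite linfunE ?comp_lfunE // => c f1 f2.
by rewrite comp_lfunDl -comp_lfunZl.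
Qed.
Lemma homk_map_homA :
  g \in homA W W' -> homk_map \in homA (homk W' U) (homk W U).
Proof.
move=> gH; apply: homA_tens => a b f; apply/lfunP=> w.
by rewrite homk_mapE !homk_actE homk_mapE (homAE _ _ gH).
Qed.
End Precomp.

(** Bimodule maps P -> Hom_k(L, U) correspond to left-linear maps P -> U, so they
    extend along inclusions that are split on the left. For a general projective
    Q with dual basis (h_i, y_i) and a left retraction s of the inclusion, the
    extension of f is F(p)(w) = sum_i f(s(p h_i(w)))(y_i). *)
Lemma ext1_zero_homk_projective (K : fdmod A) (Q U : fdmod L) :
  projective (lres K) -> projective Q -> ext1_zero K (homk Q U).
Proof.
move=> /left_retraction[s sH sK] /projective_dual_basis[I [h [y [hH Qxy]]]] f fH.
pose F0 (p : cov0 K) (w : Q) : U :=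
  \sum_i (f (s (act (cov0 K) (tens 1 (h i w : L^c)) p)) : 'Hom(Q, U)) (y i).
pose F1 (p : cov0 K) : homk Q U := linfun (F0 p).
have F1E p w : (F1 p : 'Hom(Q, U)) w = F0 p w.
  rewrite linfunE // => c u v; rewrite /F0 scaler_sumr -big_split /=.
  apply: eq_bigr => i _; rewrite linearP (tens_bilin _ _).2 actDl actZl.
  by rewrite !linearP /= add_lfunE scale_lfunE.
pose F : 'Hom(cov0 K, homk Q U) := linfun F1.
have FE p w : (F p : 'Hom(Q, U)) w = F0 p w.
  rewrite linfunE // => c u v; apply/lfunP=> x.
  rewrite add_lfunE scale_lfunE !F1E /F0 scaler_sumr -big_split /=.
  by apply: eq_bigr => i _; rewrite !linearP /= add_lfunE scale_lfunE.
exists F.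
  apply: homA_tens => a b p; apply/lfunP=> w; rewrite homk_actE !FE.
  rewrite /F0 linear_sum; apply: eq_bigr => i _ /=.
  rewrite (homAE _ _ (hH i)) act_regmod -actME.
  have -> : tens 1 (h i w : L^c) * tens a b =
      tens a (1 : L^c) * tens 1 ((b : L) * h i w : L^c).
    by rewrite !tensME mul1r mulr1 [1 * _ in RHS]mul1r.
  rewrite actME; have /= -> := homAE a _ sH.
  rewrite [f _](homAE (tens a 1) _ fH).
  by rewrite [LHS]homk_actE act1E.
move=> z; apply/lfunP=> w; rewrite FE /F0 [w in RHS]Qxy linear_sum.
apply: eq_bigr => i _ /=; rewrite -syz_actE sK (homAE _ _ fH) homk_actE.
by rewrite act1E.
Qed.

End HomBimodule.

Section ProjectiveDimension.
Variables (k : fieldType) (A : falgType k).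
Implicit Types K M N P Q Y : fdmod A.

Lemma proj_dim_le0_projective M : proj_dim_le 0 M -> projective M.
Proof.
move=> [P [d [e [[PP P0] [eH _] eS de _]]]].
have eI : injective e.
  apply/lker0P; rewrite -de -dimv_eq0.
  have /eqP := P0 1%N isT; rewrite -(limg_ker_dim (d 0%N) fullv).
  by rewrite addn_eq0 => /andP[].
have [|g gH ge] := factor_inj eH (homA_id M) eI.
  by move=> x; have /limg_fullP/(_ x)[y <-] := eS; exists y; rewrite id_lfunE.
apply: projective_retract gH eH _ (PP 0%N) => x.
by rewrite ge id_lfunE.
Qed.

Lemma proj_dim_leS n M : proj_dim_le n.+1 M ->
  exists (Q : fdmod A) (e : 'Hom(Q, M)) (eH : e \in homA Q M),
    [/\ projective Q, limg e = fullv & proj_dim_le n (submod (lker_submod eH))].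
Proof.
move=> [P [d [e [[PP P0] [eH dH] eS de dd]]]].
exists (P 0%N), e, eH; split=> //.
have [||e' e'H e'E] := factor_inj (sub_incl_homA (lker_submod eH)) (dH 0%N).
- move=> x y; rewrite !lfunE /=; apply: val_inj.
- move=> x; have dx : d 0%N x \in lker e by rewrite -de memv_img ?memvf.
  by exists (vsproj _ (d 0%N x)); rewrite lfunE /= vsprojK // => /eqP.
exists (fun i => P i.+1), (fun i => d i.+1), e'; split=> //.
  by split=> // i ni; apply: P0.
  apply/limg_fullP=> z; have : vsval z \in limg (d 0%N) by rewrite de subvsP.
  case/memv_imgP=> x _ zE; exists x; apply: subvs_inj.
  by rewrite zE -e'E lfunE.
rewrite dd; apply/vspaceP=> x; rewrite !memv_ker -e'E lfunE /=.
rewrite -[0 in LHS](linear0 (vsval : subvs_of (lker e) -> _)).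
by rewrite (inj_eq (@subvs_inj _ _ _)).
Qed.
End ProjectiveDimension.

Section HomkExact.
Variables (k : fieldType) (L : falgType k).

(** A short projective resolution of W gives a short exact sequence
    0 -> Hom_k(W, U) -> Hom_k(Q, U) -> Hom_k(W', U) -> 0 with W' the kernel of
    Q -> W, so lowering the projective dimension of W costs exactly one syzygy of
    the regular bimodule. *)
Lemma ext1_zero_homk n (W U : fdmod L) :
  proj_dim_le n W -> ext1_zero (omega n (regbim L)) (homk W U).
Proof.
elim: n W => [|n IH] W.
  move=> /proj_dim_le0_projective; apply: ext1_zero_homk_projective.
  exact: lres_regbim_projective.
move=> /proj_dim_leS[Q [e [eH [PQ eS /IH E']]]].
pose j : 'Hom(submod (lker_submod eH), Q) := sub_incl (lker e).
have jH : j \in homA (submod (lker_submod eH)) Q by apply: sub_incl_homA.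
rewrite -[omega n.+1 _]/(syz (omega n (regbim L))).
apply: (ext1_zero_shift (i := homk_map U e) (q := homk_map U j)
  _ _ _ _ _ _ E').
- exact: homk_map_homA.
- exact: homk_map_homA.
- move=> f g fg; apply/lfunP=> w; have /limg_fullP/(_ w)[x <-] := eS.
  by rewrite -!homk_mapE fg.
- move=> f; split=> [f0|[g ->]].
    exists (f \o e^-1)%VF; apply/lfunP=> x; rewrite homk_mapE comp_lfunE.
    apply/eqP; rewrite -subr_eq0 -linearB /=.
    have xK : x - (e^-1)%VF (e x) \in lker e.
      by rewrite memv_ker linearB /= limg_lfunVK ?subrr // eS memvf.
    have f0E z : (f : 'Hom(Q, U)) (j z) = 0 by rewrite -homk_mapE f0 zero_lfunE.
    have := f0E (vsproj _ (x - (e^-1)%VF (e x))).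
    by rewrite lfunE /= vsprojK // => /eqP.
  apply/lfunP=> w; rewrite !homk_mapE zero_lfunE lfunE /=.
  by have /eqP -> : e (vsval w) == 0; rewrite ?linear0 // -memv_ker subvsP.
- apply/limg_fullP=> f; exists (f \o linfun (vsproj (lker e)))%VF.
  by apply/lfunP=> w; rewrite homk_mapE comp_lfunE !lfunE /= vsvalK.
- apply: ext1_zero_homk_projective PQ.
  exact: (@lres_omega_projective _ L n.+1).
Qed.
End HomkExact.

(** * Bimodules annihilated by the radical on the left *)

Lemma ext1_zero_retract (k : fieldType) (A : falgType k) (K X Y : fdmod A)
    (i : 'Hom(X, Y)) (r : 'Hom(Y, X)) :
  i \in homA X Y -> r \in homA Y X -> (forall x, r (i x) = x) ->
  ext1_zero K Y -> ext1_zero K X.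
Proof.
move=> iH rH ri EY f fH; have [F FH Ff] := EY _ (homA_comp iH fH).
exists (r \o F)%VF; first exact: homA_comp.
by move=> z; rewrite comp_lfunE Ff comp_lfunE ri.
Qed.

Section SeparabilityIdempotent.
Variables (k : fieldType) (B : falgType k).

(** The idempotent is the value at 1 of a bimodule section of the multiplication
    of B with itself. *)
Lemma separability_idempotent : separable_algebra B ->
  exists e : envalg B, regbim_act e 1 = 1 /\
    forall b : B, tens b (1 : B^c) * e = tens 1 (b : B^c) * e.
Proof.
move=> PB.
pose m : 'Hom(envalg B, B) := linfun (fun t : envalg B => regbim_act t 1 : B).
have mE t : m t = regbim_act t 1.
  by rewrite linfunE // => c u v; rewrite regbim_linear add_lfunE scale_lfunE.
have mH : m \in homA (regmod (envalg B)) (regbim B).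
  by apply/mem_homA=> t u; rewrite !mE act_regmod regbimM comp_lfunE.
have mS : limg m = fullv.
  apply/limg_fullP=> b; exists (tens b 1).
  by rewrite mE (regbim_actE b 1 1) !mulr1.
have [s sH ms] := PB _ _ _ _ mH mS (homA_id _).
exists (s 1); split=> [|b]; first by rewrite -mE -comp_lfunE ms id_lfunE.
have sE t : t * s 1 = s (regbim_act t 1).
  by rewrite -act_regmod -(homAE _ _ sH).
by rewrite !sE (regbim_actE b 1 1) (regbim_actE 1 b 1) !mulr1 !mul1r.
Qed.
End SeparabilityIdempotent.

Section Averaging.
Variables (k : fieldType) (L B : falgType k) (pi : 'AHom(L, B)).
Hypothesis piS : limg pi = fullv.
Local Notation A := (envalg L).

Definition ahom_act (a : L) : 'End(B) := amull (pi a).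
Fact ahom_act_linear : linear ahom_act.
Proof.
by move=> c a b; rewrite /ahom_act linearP (@amull_is_linear k B).
Qed.
Fact ahom_act1 : ahom_act 1 = \1%VF.
Proof. by rewrite /ahom_act rmorph1 amull1. Qed.
Fact ahom_actM a b : ahom_act (a * b) = (ahom_act a \o ahom_act b)%VF.
Proof.
by apply/lfunP=> x; rewrite comp_lfunE !lfunE /= rmorphM mulrA.
Qed.
Definition ahom_mod : fdmod L := FdMod ahom_act_linear ahom_act1 ahom_actM.

(** A linear section of pi; it respects products only up to the kernel of pi, an
    error that X does not see ([act_congr]). *)
Let sec (b : B) : L := (pi^-1)%VF b.
Let secK b : pi (sec b) = b.
Proof. by apply: limg_lfunVK; rewrite piS memvf. Qed.

Let secP c a b : sec (c *: a + b) = c *: sec a + sec b.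
Proof. exact: linearP. Qed.
Let secD a b : sec (a + b) = sec a + sec b.
Proof. exact: linearD. Qed.
Let secZ c a : sec (c *: a) = c *: sec a.
Proof. exact: linearZ. Qed.

Variable X : bimod L.
Hypothesis kerX : forall a x, pi a = 0 -> act X (tens a (1 : L^c)) x = 0.
Local Notation M := (lres X).
Local Notation W := (lres (dualbim X)).

Let act_congr a b x : pi a = pi b -> act M a x = act M b x.
Proof.
move=> ab; apply/eqP; rewrite -subr_eq0; apply/eqP.
have -> : act M a x - act M b x = act M (a - b) x.
  by rewrite actDl -[- b]scaleN1r actZl scaleN1r.
by apply: kerX; rewrite linearB /= ab subrr.
Qed.

Let dual_actE a (xi : 'Hom(X, k^o)) x :
  act W a xi x = xi (act X (tens 1 (a : L^c)) x).
Proof. by rewrite [LHS]dualbim_actE (env_swapE a 1). Qed.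

(** For t the sum of the u_i (x) v_i, [avg t] sends x to the linear map
    xi |-> sum_i xi(v_i x) u_i, that is, to the element sum_i u_i (x) v_i x of
    B (x) X written as a map from DX to B. *)
Let avg_tens (x : X) (xi : 'Hom(X, k^o)) (u : B) (v : B^c) : B :=
  (xi (act M (sec v) x) : k) *: u.
Let avg_bilin x xi : bilin (avg_tens x xi).
Proof.
split=> [v c u u'|u c v v']; rewrite /avg_tens.
  by rewrite scalerDr !scalerA mulrC.
by rewrite secP actDl actZl linearP scalerDl scalerA.
Qed.
Let avg (t : envalg B) (x : X) (xi : 'Hom(X, k^o)) : B := tlift (avg_tens x xi) t.
Let avgE u v x xi : avg (tens u (v : B^c)) x xi = (xi (act M (sec v) x) : k) *: u.
Proof. by rewrite /avg (tliftE _ _ (avg_bilin _ _)). Qed.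
Let avgD t u x xi : avg (t + u) x xi = avg t x xi + avg u x xi.
Proof. by have := tlift_linear (avg_tens x xi) 1 t u; rewrite !scale1r. Qed.

Let avg_map t : 'Hom(X, homk W ahom_mod) :=
  linfun (fun x : X => linfun (avg t x) : 'Hom(W, ahom_mod)).
Let avg_mapE t x xi : (avg_map t x : 'Hom(W, ahom_mod)) xi = avg t x xi.
Proof.
have lin y : linear (avg t y).
  move=> c f g; apply: tlift_lin_fun => u v.
  by rewrite /avg_tens add_lfunE scale_lfunE scalerDl scalerA.
rewrite !linfunE // => c y z; apply/lfunP=> f.
rewrite add_lfunE scale_lfunE !linfunE //; apply: tlift_lin_fun => u v.
by rewrite /avg_tens !linearP /= scalerDl scalerA.
Qed.

(** Right linearity is immediate. Left linearity is the centrality of e: moving a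
    inside xi(v_i a x) multiplies e by 1 (x) a, which is the same as multiplying
    it by a (x) 1. *)
Let avg_map_homA e :
  (forall b : B, tens b (1 : B^c) * e = tens 1 (b : B^c) * e) ->
  avg_map e \in homA X (homk W ahom_mod).
Proof.
move=> eP; apply: homA_tens => a b x; apply/lfunP=> xi.
rewrite homk_actE !avg_mapE lfunE /=.
have avgl t : pi a * avg t x (act W b xi) =
    avg (tens (pi a) (1 : B^c) * t) x (act W b xi).
  elim/tensor_ind: t => [u v|t u IH IH']; last first.
    by rewrite mulrDr !avgD mulrDr IH IH'.
  by rewrite tensME mul1r !avgE scalerAr.
rewrite [RHS]avgl eP; elim/tensor_ind: e {eP avgl} => [u v|t u IH IH'].
  rewrite tensME mul1r (avgE u v) (avgE u ((v : B) * pi a)) dual_actE.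
  rewrite (act_congr (a := sec ((v : B) * pi a)) (b := sec v * a)); last first.
    by rewrite rmorphM /= !secK.
  have -> : act M (sec v) (act X (tens a b) x) =
      act X (tens 1 b) (act M (sec v * a) x); last by [].
  rewrite /= /lres_act -!actME !tensME mul1r mulr1.
  by rewrite mul1r.
by rewrite mulrDr !avgD IH IH'.
Qed.

Let x_ (j : 'I_(\dim {:X})) : X := (vbasis {:X})`_j.
Let dx (j : 'I_(\dim {:X})) : 'Hom(X, k^o) :=
  linfun (coord (vbasis {:X}) j : X -> k^o).
Let dxE j x : dx j x = coord (vbasis {:X}) j x.
Proof. by rewrite lfunE. Qed.

(** The multiplication B (x) X -> X, under the identification of Hom_k(DX, B) with
    B (x) X. *)
Let eval (f : homk W ahom_mod) : X :=
  \sum_j act M (sec ((f : 'Hom(W, ahom_mod)) (dx j))) (x_ j).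
Let eval_map : 'Hom(homk W ahom_mod, X) := linfun eval.
Let eval_mapE f : eval_map f = eval f.
Proof.
rewrite linfunE // => c g h; rewrite /eval scaler_sumr -big_split.
by apply: eq_bigr => j _; rewrite add_lfunE scale_lfunE secP actDl actZl.
Qed.

Let eval_map_homA : eval_map \in homA (homk W ahom_mod) X.
Proof.
apply: homA_tens => a b f; rewrite !eval_mapE /eval.
(* The transpose of right multiplication by b has the transposed matrix. *)
have dxb (j : 'I_(\dim {:X})) : act W b (dx j) =
    \sum_i coord (vbasis {:X}) j (act X (tens 1 (b : L^c)) (x_ i)) *: dx i.
  apply/lfunP=> x; rewrite dual_actE sum_lfunE {1}(coord_vbasis (memvf x)).
  rewrite !linear_sum; apply: eq_bigr => i _.
  by rewrite scale_lfunE dxE !linearZ /= dxE; apply: mulrC.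
pose z i : B := (f : 'Hom(W, ahom_mod)) (dx i).
transitivity (act M a (\sum_j \sum_i
    coord (vbasis {:X}) j (act X (tens 1 (b : L^c)) (x_ i)) *:
      act M (sec (z i)) (x_ j))).
  rewrite linear_sum; apply: eq_bigr => j _.
  rewrite [X in sec X](homk_actE a b f (dx j)) lfunE /=.
  rewrite [act W b _]dxb linear_sum /=.
  rewrite (act_congr (b := a * sec (\sum_i
      coord (vbasis {:X}) j (act X (tens 1 (b : L^c)) (x_ i)) *: z i))); last first.
    rewrite rmorphM /= !secK; congr (_ * _).
    by apply: eq_bigr => i _; rewrite linearZ.
  rewrite actME; rewrite (linear_sumE _ _ secP) act_suml; congr (act M a _).
  by apply: eq_bigr => i _; rewrite actZl.
rewrite exchange_big linear_sum [RHS]linear_sum; apply: eq_bigr => i _.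
transitivity (act M a (act M (sec (z i)) (act X (tens 1 (b : L^c)) (x_ i)))).
  congr (act M a _); rewrite [act X _ (x_ i) in RHS](coord_vbasis (memvf _)).
  by rewrite linear_sum; apply: eq_bigr => j _; rewrite [RHS]linearZ.
by rewrite /= /lres_act -!actME !tensME !mulr1 !mul1r.
Qed.

Let eval_avg t x : eval_map (avg_map t x) = act M (sec (regbim_act t 1)) x.
Proof.
rewrite eval_mapE /eval.
elim/tensor_ind: t => [u v|t u IH IH']; last first.
  rewrite regbimD add_lfunE secD actDl -IH -IH' -big_split.
  by apply: eq_bigr => j _; rewrite !avg_mapE avgD secD actDl.
rewrite (regbim_actE u v 1) mulr1.
rewrite (act_congr (b := sec u * sec v)); last by rewrite rmorphM /= !secK.
rewrite actME [act M (sec v) x in RHS](coord_vbasis (memvf _)) linear_sum.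
apply: eq_bigr => j _.
by rewrite avg_mapE avgE dxE secZ actZl linearZ.
Qed.

(** With e the separability idempotent, x |-> sum_i u_i (x) v_i x followed by
    multiplication is multiplication by sum_i u_i v_i = 1, so X is a direct
    summand of Hom_k(DX, B). *)
Lemma ext1_zero_left_semisimple (K : fdmod A) : separable_algebra B ->
  ext1_zero K (homk W ahom_mod) -> ext1_zero K X.
Proof.
move=> /separability_idempotent[e [e1 eP]].
apply: (ext1_zero_retract (avg_map_homA eP) eval_map_homA) => x.
rewrite eval_avg e1 (act_congr (b := 1)) ?act1E //.
by rewrite secK rmorph1.
Qed.
End Averaging.

(** * Projective dimension of the regular bimodule *)

(** The kernel of an extension F of f to the projective cover, together with the
    syzygy, is the whole cover, because F takes no value outside those of f. The
    syzygy being superfluous, F vanishes. *)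
Lemma ext1_zero_syz_quotient (k : fieldType) (A : falgType k) (K X : fdmod A)
    (f : 'Hom(syz K, X)) :
  ext1_zero K X -> f \in homA (syz K) X -> limg f = fullv -> forall x : X, x = 0.
Proof.
move=> EX fH /limg_fullP fS; have [F FH Ff] := EX f fH.
have FK : (lker F + lker (cov0_map K))%VS = fullv.
  apply/vspaceP=> p; rewrite memvf; have [z fz] := fS (F p).
  rewrite -[p](subrK (vsval z)) memv_add ?subvsP //.
  by rewrite memv_ker linearB /= Ff fz subrr.
have F0 := pc_min (lker_submod FH) FK.
move=> x; have [z <-] := fS x; rewrite -Ff; apply/eqP.
by rewrite -memv_ker F0 memvf.
Qed.

Section Nakayama.
Variables (k : fieldType) (L : falgType k).

(** Nakayama's lemma: V is a maximal proper submodule, and for x outside V the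
    left ideal of the b with b x in V is maximal. *)
Lemma nakayama (M : fdmod L) : (exists x : M, x <> 0) ->
  exists V : {vspace M}, V <> fullv /\
    forall a x, in_jacobson_radical a -> act M a x \in V.
Proof.
move=> [x0 x0N].
pose proper (V : {vspace M}) := is_submod V /\ V <> fullv.
have exd : exists d, `[< exists2 V, proper V & \dim V = d >].
  exists (\dim (0%VS : {vspace M})); apply/asboolP; exists 0%VS => //; split.
    by move=> a x; rewrite !memv0 => /eqP ->; rewrite linear0.
  by move/vspaceP/(_ x0); rewrite memvf memv0 => /eqP.
have led d : `[< exists2 V, proper V & \dim V = d >] -> (d <= \dim {:M})%N.
  by move=> /asboolP[V _ <-]; apply/dimvS/subvf.
case: (ex_maxnP exd led) => d /asboolP[V [VM VN] Vd] Vmax.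
have {d Vd}Vmax U : is_submod U -> (V <= U)%VS -> U = V \/ U = fullv.
  move=> UM VU; case: (pselect (U = fullv)) => [|UN]; first by right.
  left; apply/esym/eqP; rewrite eqEdim VU Vd; apply: Vmax.
  by apply/asboolP; exists U.
exists V; split=> // a x ra; case: (boolP (x \in V)) => [/VM //|xV].
pose ev : 'Hom(L, M) := linfun (fun b => act M b x).
have evE b : ev b = act M b x.
  by rewrite linfunE // => c u v; rewrite actDl actZl.
suff : a \in (ev @^-1: V)%VS by rewrite -memv_preim evE.
apply: ra; split.
- by move=> b c; rewrite act_regmod -!memv_preim !evE actME; apply: VM.
- by move/vspaceP/(_ 1); rewrite memvf -memv_preim evE act1E (negPf xV).
move=> J JM IJ; case: (Vmax (ev @: J + V)%VS).
- move=> b _ /memv_addP[_ /memv_imgP[j jJ ->] [v vV ->]].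
  rewrite linearD memv_add ?VM //= evE -actME -evE memv_img //.
  by have := JM b j jJ; rewrite act_regmod.
- exact: addvSr.
- move=> UV; left; apply/eqP; rewrite eqEsubv IJ andbT.
  apply/subvP=> j jJ; rewrite -memv_preim -UV.
  by apply: (subvP (addvSl _ _)); apply: memv_img.
- move=> UT; right; apply/vspaceP=> b; rewrite memvf.
  have : x \in (ev @: J + V)%VS by rewrite UT memvf.
  case/memv_addP=> _ /memv_imgP[j jJ ->] [v vV xE].
  have I1 : 1 - j \in (ev @^-1: V)%VS.
    by rewrite -memv_preim linearB /= !evE act1E {1}xE evE addrC addKr.
  have J1 : 1 \in J by rewrite -(subrK j 1) memvD // (subvP IJ).
  by have := JM b 1 J1; rewrite act_regmod mulr1.
Qed.
End Nakayama.

Section KernelMultiples.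
Variables (k : fieldType) (L B : falgType k) (pi : 'AHom(L, B)).
Variable N : bimod L.

(** The sub-bimodule (ker pi) N. *)
Definition ker_mul : {vspace N} :=
  (\sum_(i < \dim (lker pi))
     limg (act N (tens (vbasis (lker pi))`_i (1%R : L^c))))%VS.

Lemma mem_ker_mul a x : pi a = 0 -> act N (tens a (1 : L^c)) x \in ker_mul.
Proof.
move=> a0; have aK : a \in lker pi by rewrite memv_ker a0.
rewrite (coord_vbasis aK) (linear_sumE _ _ ((tens_bilin _ _).1 _)) act_suml.
apply: memv_suml => i _; rewrite actZl memvZ //.
by apply: (subvP (sumv_sup i _ (subvv _))) => //; rewrite memv_img ?memvf.
Qed.

Lemma ker_mul_le (V : {vspace N}) :
  (forall a x, pi a = 0 -> act N (tens a (1 : L^c)) x \in V) ->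
  (ker_mul <= V)%VS.
Proof.
move=> NV; apply/subv_sumP=> i _; apply/subvP=> _ /memv_imgP[x _ ->].
by apply: NV; apply/eqP; rewrite -memv_ker vbasis_mem // mem_nth ?size_tuple.
Qed.

Lemma ker_mul_submod : is_submod ker_mul.
Proof.
move=> t x; elim/tensor_ind: t => [a b|t u IH IH'] xU; last first.
  by rewrite actDl memvD ?IH ?IH'.
case/memv_sumP: xU => y yU ->; rewrite linear_sum; apply: memv_suml => i _.
case/memv_imgP: (yU i isT) => w _ -> /=; rewrite -actME.
set v := (vbasis (lker pi))`_i.
have -> : tens a b * tens v (1 : L^c) = tens (a * v) (1 : L^c) * tens 1 b.
  by rewrite !tensME !mulr1 mul1r.
rewrite actME; apply: mem_ker_mul; rewrite rmorphM /=.
have /eqP -> : pi v == 0; last by rewrite mulr0.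
by rewrite -memv_ker vbasis_mem // mem_nth ?size_tuple.
Qed.

End KernelMultiples.

(** The projective dimension of L as a bimodule is at most d: if N = Omega^(d+1) L
    were nonzero, its nonzero quotient by rN would contradict
    [ext1_zero_syz_quotient]. *)
Lemma omega_succ_gldim_eq0 (k : fieldType) (L : falgType k) (d : nat) :
  separable_mod_radical L -> (forall M : fdmod L, proj_dim_le d M) ->
  forall z : omega d.+1 (regbim L), z = 0.
Proof.
move=> [B [pi [piS piK Bsep]]] pd; set K := omega d (regbim L).
case: (pselect (exists z : lres (syz K), z <> 0)) => [zN|zN z]; last first.
  by apply: contrapT => z0; apply: zN; exists z.
have [V [VN VK]] := nakayama zN.
have UM := ker_mul_submod (pi := pi) (N := syz K); pose X := quotmod UM.
have UV : (ker_mul pi (syz K) <= V)%VS.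
  by apply: ker_mul_le => a x /piK; apply: VK.
have X0 (x : X) : x = 0.
  apply: ext1_zero_syz_quotient (quot_proj_homA UM) (limg_quot_proj _) x.
  apply: (ext1_zero_left_semisimple (pi := pi)) => // [a x a0|].
    have [y ->] := quot_projP x.
    transitivity (quot_proj (ker_mul pi (syz K)) (act (syz K) (tens a 1) y)).
      exact: (quot_actE UM).
    by apply/eqP; rewrite quot_proj_eq0 mem_ker_mul.
  exact: ext1_zero_homk.
case: VN; apply/eqP; rewrite eqEsubv subvf.
apply/subvP=> z _; apply: (subvP UV).
by rewrite -quot_proj_eq0; apply/eqP/X0.
Qed.

(** * Vanishing of the translate *)

Section Vanish.
Variables (k : fieldType) (A : falgType k).
Implicit Types M : fdmod A.

(** Minimality is essential: the zero submodule supplements the kernel. *)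
Lemma cov0_eq0 M : (forall y : M, y = 0) -> forall x : cov0 M, x = 0.
Proof.
move=> M0 x; apply/eqP; rewrite -memv0.
have W0 : is_submod (0%VS : {vspace cov0 M}).
  by move=> a y; rewrite !memv0 => /eqP ->; rewrite linear0.
suff -> : 0%VS = {:cov0 M}%VS by apply: memvf.
apply: (@pc_min _ _ _ (proj_cover M) _ W0); rewrite add0v.
by apply/vspaceP=> y; rewrite memvf memv_ker; apply/eqP/M0.
Qed.

Lemma syz_eq0 M : (forall y : M, y = 0) -> forall z : syz M, z = 0.
Proof.
by move=> M0 z; apply: subvs_inj; rewrite linear0; apply: cov0_eq0.
Qed.

Lemma hom_tr_eq0 M (t : 'Hom(tr M, k^o)) :
  (forall g, t (quot_proj (limg (homreg_map (pres_map M))) g) = 0) -> t = 0.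
Proof.
move=> t0; apply/lfunP=> y; rewrite zero_lfunE.
by have [g ->] := quot_projP y; apply: t0.
Qed.

Lemma tau_eq0 M : (forall z : syz M, z = 0) -> forall t : tau M, t = 0.
Proof.
move=> M0 t; apply: hom_tr_eq0 => g.
suff -> : g = 0 by rewrite !linear0.
apply: subvs_inj; apply/lfunP=> x.
by rewrite (cov0_eq0 M0 x) !linear0.
Qed.
End Vanish.

(** * One-sided functionals on the dual of a projective bimodule *)

Section OneSided.
Variables (k : fieldType) (L : falgType k).
Local Notation A := (envalg L).

(** A left-linear map from a projective bimodule to A arises from bimodule maps
    F_v by operations on the second factor of A only: the sum of the
    c_j (x) e_j goes to c_m (x) rho for a fixed index m. A relation in the first
    factor satisfied by every bimodule map is therefore satisfied by psi. *)
Lemma left_linear_expansion (P : fdmod A) (psi : 'Hom(P, A)) :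
  projective P -> psi \in homA (lres P) (lres (regmod A)) ->
  exists (V : finType) (F : V -> 'Hom(P, regmod A))
      (m : V -> 'I_(\dim {:L^c})) (rho : V -> L^c),
    (forall v, F v \in homA P (regmod A)) /\
    (forall y, psi y = \sum_v tens (col_coef (m v) (F v y)) (rho v)).
Proof.
move=> /projective_dual_basis[I [h [y [hH Pxy]]]] psiH.
pose e (i : 'I_(\dim {:L})) : L := (vbasis {:L})`_i.
pose G i (m : 'I_(\dim {:L^c})) : A :=
  psi (act P (tens 1 (vbasis {:L^c})`_m) (y i)).
exists (I * ('I_(\dim {:L^c}) * 'I_(\dim {:L})))%type.
exists (fun v => (amulr (tens (e v.2.2) (1%R : L^c)) \o h v.1)%VF).
exists (fun v => v.2.1), (fun v => row_coef v.2.2 (G v.1 v.2.1)); split.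
  move=> v; apply/mem_homA=> t x; rewrite !comp_lfunE (homAE _ _ (hH _)).
  by rewrite !act_regmod !lfunE /= mulrA.
move=> x; rewrite {1}(Pxy x) linear_sum.
rewrite -(pair_bigA _ (fun i mu => tens (col_coef mu.1
  ((amulr (tens (e mu.2) (1%R : L^c)) \o h i)%VF x)) (row_coef mu.2 (G i mu.1)))) /=.
apply: eq_bigr => i _; set t := h i x.
rewrite -(pair_bigA _ (fun m u => tens (col_coef m
  ((amulr (tens (e u) (1%R : L^c)) \o h i)%VF x)) (row_coef u (G i m)))) /=.
rewrite {1}(col_coef_sum t) act_suml linear_sum; apply: eq_bigr => m _.
transitivity (tens (col_coef m t) (1 : L^c) * G i m).
  rewrite -[X in tens X _]mulr1 -[X in tens _ X]mul1r -tensME /= actME.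
  have /= -> := homAE (col_coef m t) _ psiH.
  by rewrite /lres_act act_regmod.
rewrite {1}(row_coef_sum (G i m)) mulr_sumr; apply: eq_bigr => u _.
rewrite comp_lfunE lfunE /= -/t tensME mul1r; congr (tens _ _).
by rewrite col_coefMr.
Qed.

(** The functional phi comes from an element of DL (x)_L P, namely the sum over i
    of e_(j i)^* (x) p_i for the basis (e_j) of L: it sends g to the sum of the
    (e_(j i)^* (x) 1)(g(p_i)), whose coordinates are entries of the matrices
    g(p_i). To see it, expand g in a dual basis (f_i, y_i) of P as the sum of the
    f_i g(y_i), and expand each g(y_i) in its first factor; the second factor
    comes out of phi by linearity. *)
Lemma one_sided_functional_coord (P : fdmod A) (phi : 'Hom(homreg P, L)) :
  projective P ->
  (forall (b : L) g,
     phi (act (homreg P) (tens 1 (b : L^c) : A^c) g) = b * phi g) ->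
  exists (I : finType) (j : I -> 'I_(\dim {:L})) (p : I -> P),
    forall g m, coord (vbasis {:L^c}) m (phi g : L^c) =
      \sum_i ((vsval g (p i) : A) (j i) m).
Proof.
move=> /projective_dual_basis[I [f [p [fH Pxy]]]] phiM.
pose e (i : 'I_(\dim {:L})) : L := (vbasis {:L})`_i.
pose f' i : homreg P := vsproj (homA P (regmod A)) (f i).
have f'E i x : vsval (f' i) x = f i x by rewrite vsprojK.
have actE (t : A) (g : homreg P) x :
    vsval (act (homreg P) (t : A^c) g) x = vsval g x * t.
  exact: homreg_actE.
pose c i j : L := phi (act (homreg P) (tens (e j) (1 : L^c) : A^c) (f' i)).
exists (I * 'I_(\dim {:L}))%type, (fun v => v.2).
exists (fun v => act P (tens 1 (c v.1 v.2 : L^c)) (p v.1)) => g m.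
rewrite -(pair_bigA _ (fun i j =>
  (vsval g (act P (tens 1 (c i j : L^c)) (p i)) : A) j m)) /=.
have gE : g = \sum_i \sum_j
    act (homreg P) (tens 1 (row_coef j (vsval g (p i))) : A^c)
      (act (homreg P) (tens (e j) (1 : L^c) : A^c) (f' i)).
  apply: subvs_inj; apply/lfunP=> x.
  rewrite {1}(Pxy x) !linear_sum sum_lfunE; apply: eq_bigr => i _.
  have /= -> := homAE (f i x) (p i) (subvsP g).
  rewrite act_regmod {1}(row_coef_sum (vsval g (p i))) mulr_sumr.
  rewrite linear_sum sum_lfunE; apply: eq_bigr => j _ /=.
  by rewrite !actE f'E -mulrA tensME mulr1 [1 * _]mul1r.
rewrite {1}gE !linear_sum /=; apply: eq_bigr => i _; rewrite !linear_sum.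
apply: eq_bigr => j _ /=; rewrite phiM -/(c i j).
have /= -> := homAE (tens 1 (c i j : L^c)) (p i) (subvsP g).
by rewrite act_regmod -coord_row_coef row_coefM.
Qed.

(** Under the description of one-sided functionals above, this is the injectivity
    of DL (x)_L P1 -> DL (x)_L P0 for d split on the left. Concretely, any
    g in Hom_A(P1, A) equals (g s) d, where g s is only left-linear but has an
    expansion in bimodule maps P0 -> A, and phi kills those composed with d. *)
Lemma one_sided_functional_eq0 (P1 P0 : fdmod A)
    (d : 'Hom(P1, P0)) (s : 'Hom(P0, P1)) (phi : 'Hom(homreg P1, L)) :
    projective P1 -> projective P0 -> d \in homA P1 P0 ->
    s \in homA (lres P0) (lres P1) -> (forall x, s (d x) = x) ->
    (forall (b : L) g,
       phi (act (homreg P1) (tens 1 (b : L^c) : A^c) g) = b * phi g) ->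
    (forall f, phi (homreg_map d f) = 0) ->
  phi = 0.
Proof.
move=> PP1 PP0 dH sH sd phiM phid; apply/lfunP=> g; rewrite zero_lfunE.
have [I [j [p phiE]]] := one_sided_functional_coord PP1 phiM.
have gsH : (vsval g \o s)%VF \in homA (lres P0) (lres (regmod A)).
  exact: homA_comp (lres_homA (subvsP g)) sH.
have [V [F [m [rho [FH gsE]]]]] := left_linear_expansion PP0 gsH.
have Fd v : \sum_i (F v (d (p i)) : A) (j i) (m v) = 0.
  have := phiE (homreg_map d (vsproj _ (F v))) (m v).
  rewrite phid [LHS]linear0 => E; rewrite [RHS]E; apply: eq_bigr => i _.
  by rewrite homreg_mapE // vsprojK.
suff phi0 n : coord (vbasis {:L^c}) n (phi g : L^c) = 0.
  rewrite [LHS](coord_vbasis (memvf (phi g : L^c))) big1 // => n _.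
  by rewrite phi0 scale0r.
rewrite phiE.
transitivity (\sum_i \sum_v (F v (d (p i)) : A) (j i) (m v) *
                coord (vbasis {:L^c}) n (rho v)).
  apply: eq_bigr => i _; rewrite -{1}[p i]sd -[vsval g _]comp_lfunE gsE summxE.
  by apply: eq_bigr => v _; rewrite mxE coord_col_coef.
rewrite exchange_big big1 // => v _.
by rewrite -mulr_suml Fd mul0r.
Qed.

End OneSided.

(** * Vanishing in top degree *)

Lemma pres_map_left_retraction (k : fieldType) (L : falgType k) (M : bimod L) :
  projective (lres M) -> (forall z : syz (syz M), z = 0) ->
  exists2 s : 'Hom(cov0 M, cov1 M), s \in homA (lres (cov0 M)) (lres (cov1 M)) &
    forall x, s (pres_map M x) = x.
Proof.
move=> PM M2; have [r rH rK] := left_retraction PM.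
pose p := cov0_map (syz M); have pH : p \in homA (cov1 M) (syz M) := pc_homA _.
have [|q qH qp] := factor_surj pH (homA_id _) (@cov0_mapS _ _ _).
  by move=> x /syz_exact[z ->]; rewrite (M2 z) !linear0.
exists (q \o r)%VF; first exact: homA_comp (lres_homA qH) rH.
move=> x; rewrite !comp_lfunE [sub_incl _ _]lfunE rK.
by rewrite [q _]qp id_lfunE.
Qed.

(** For xi in DL and g in Hom_A(P1, A), evaluating u(xi) at the class of g is
    linear in xi, so it equals xi(phi(g)) for some phi(g) in L. That u respects
    the action on one side is exactly the one-sided linearity of phi, and phi
    vanishes on the image of Hom_A(P0, A) because u(xi) is a functional on the
    cokernel Tr M. *)
Lemma hom_dual_tau_eq0 (k : fieldType) (L : falgType k) (M : bimod L)
    (u : 'Hom(dualbim (regbim L), tau M)) :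
  projective (lres M) -> (forall z : syz (syz M), z = 0) ->
  u \in homA (dualbim (regbim L)) (tau M) -> u = 0.
Proof.
move=> PM M2 uH; have [s sH sd] := pres_map_left_retraction PM M2.
have dH := pres_map_homA M; set d := pres_map M in sd dH.
pose P := cov1 M; pose T := limg (homreg_map d).
pose ev (xi : 'Hom(L, k^o)) (g : homreg P) : k :=
  (u xi : 'Hom(tr M, k^o)) (quot_proj T g).
pose eps (i : 'I_(\dim {:L})) : 'Hom(L, k^o) :=
  linfun (coord (vbasis {:L}) i : L -> k^o).
pose phi : 'Hom(homreg P, L) :=
  linfun (fun g => \sum_i ev (eps i) g *: (vbasis {:L})`_i).
have phiE g (xi : 'Hom(L, k^o)) : xi (phi g) = ev xi g.
  rewrite linfunE => [|c g1 g2]; last first.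
    rewrite scaler_sumr -big_split; apply: eq_bigr => i _.
    by rewrite /ev !linearP scalerDl scalerA.
  have xiE : xi = \sum_(i < \dim {:L}) (xi (vbasis {:L})`_i : k) *: eps i.
    apply/lfunP=> x; rewrite {1}(coord_vbasis (memvf x)) linear_sum sum_lfunE.
    by apply: eq_bigr => i _; rewrite linearZ scale_lfunE lfunE; apply: mulrC.
  rewrite {2}xiE /ev [u _]linear_sum sum_lfunE linear_sum.
  by apply: eq_bigr => i _; rewrite !linearZ /= scale_lfunE; apply: mulrC.
have phi_inj (a b : L) : (forall xi : 'Hom(L, k^o), xi a = xi b) -> a = b.
  move=> ab; rewrite (coord_vbasis (memvf a)) (coord_vbasis (memvf b)).
  by apply: eq_bigr => i _; have := ab (eps i); rewrite !lfunE /= => ->.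
have phi0 : phi = 0.
  apply: (one_sided_functional_eq0 (d := d) (s := s)) => //;
    try exact: cov0_projective.
    move=> b g; apply: phi_inj => xi; rewrite phiE.
    have -> : xi (b * phi g) =
        act (dualbim (regbim L)) (tens 1 (b : L^c)) xi (phi g).
      rewrite [RHS]dualbim_actE (env_swapE 1 b).
      by rewrite [act _ _ _](regbim_actE b 1) mulr1.
    rewrite phiE /ev (homAE _ _ uH) [RHS]dual_actE.
    congr (_ _); symmetry.
    exact: (quot_actE (limg_submod (homreg_map_homA dH))).
  move=> f; apply: phi_inj => xi; rewrite phiE linear0 /ev.
  have -> : quot_proj T (homreg_map d f) = 0.
    by apply/eqP; rewrite quot_proj_eq0 memv_img ?memvf.
  by rewrite linear0.
apply/lfunP=> xi; rewrite zero_lfunE; apply: hom_tr_eq0 => g.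
by rewrite -[LHS]/(ev xi g) -phiE phi0 zero_lfunE linear0.
Qed.

Lemma subvs_homA_eq0 (k : fieldType) (A : falgType k) (M N : fdmod A)
    (u : subvs_of (homA M N)) :
  (forall y : N, y = 0) -> u = 0.
Proof. by move=> N0; apply/subvs_inj/lfunP=> x; rewrite [LHS]N0 [RHS]N0. Qed.

Theorem proposition4p1 (k : fieldType) (L : falgType k) (d : nat)
    (Lsep : separable_mod_radical L) (Lgldim : has_global_dim L d) :
  (forall (X : bimod L) (n : nat), (d.+1 <= n)%N ->
     (forall u : HHtau_coh n X, u = 0%R) /\
     (forall u : HHtau_hom n X, u = 0%R)) /\
  ((1 <= d)%N -> forall u : HHtau_hom d (regbim L), u = 0%R).
Proof.
have [pd _] := Lgldim; have omega0 := omega_succ_gldim_eq0 Lsep pd.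
split=> [X n dn | d1 u].
  have tau0 : forall t : tau_n n (regbim L), t = 0.
    (* tau_n is built on Omega^(n-1), whose syzygy Omega^n vanishes. *)
    apply: tau_eq0; rewrite -[syz _]/(omega n.-1.+1 (regbim L)).
    rewrite prednK ?(leq_trans _ dn) // -(subnK dn).
    elim: (n - d.+1)%N => [//|m IH]; rewrite addSn; exact: syz_eq0.
  split=> u; last exact: subvs_homA_eq0.
  by apply/lfunP=> f; rewrite (subvs_homA_eq0 f tau0) !linear0.
apply: subvs_inj; apply: hom_dual_tau_eq0 (subvsP u).
  exact: lres_omega_projective.
rewrite -[syz (syz _)]/(omega d.-1.+2 (regbim L)).
by rewrite (prednK d1).
Qed.
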